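(* Let $f:\mathbb R\to\mathbb R$ be continuous with $f(u_2)-f(u_1)\le\kappa(u_2-u_1)$ for all $u_1<u_2$, for some $\kappa\in\mathbb R$. For every $T>0$ and $z\in C_b([0,T]\times\mathbb R^d)$ there exists $u\in C_b([0,T]\times\mathbb R^d)$ solving $$u(t,x)=\int_0^t\int_{\mathbb R^d}G(t-s,x-y)f(u(s,y))dyds+z(t,x),\quad (t,x)\in[0,T]\times\mathbb R^d.$$
   Context: $G(t,x)=(2\pi t)^{-d/2}e^{-|x|^2/(2t)}$; $C_b([0,T]\times\mathbb R^d)$ is the space of bounded continuous real functions on $[0,T]\times\mathbb R^d$. *)

(* Defs.v *)
From Stdlib Require Import Reals.
Open Scope R_scope.

Fixpoint Rn (d : nat) : Type :=
  match d with O => unit | S n => (R * Rn n)%type end.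

Fixpoint Rn_sub (d : nat) : Rn d -> Rn d -> Rn d :=
  match d return Rn d -> Rn d -> Rn d with
  | O => fun _ _ => tt
  | S n => fun x y => (fst x - fst y, Rn_sub n (snd x) (snd y))
  end.

Fixpoint Rn_sqnorm (d : nat) : Rn d -> R :=
  match d return Rn d -> R with
  | O => fun _ => 0
  | S n => fun x => fst x * fst x + Rn_sqnorm n (snd x)
  end.

Definition Rn_dist (d : nat) (x y : Rn d) : R := sqrt (Rn_sqnorm d (Rn_sub d x y)).

Definition G (d : nat) (t : R) (x : Rn d) : R :=
  Rpower (2 * PI * t) (- (INR d) / 2) * exp (- Rn_sqnorm d x / (2 * t)).

Definition is_RInt (f : R -> R) (a b v : R) : Prop :=
  exists pr : Riemann_integrable f a b, RiemannInt pr = v.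

Definition is_RInt_R (f : R -> R) (v : R) : Prop :=
  (forall a b, a <= b -> exists w, is_RInt f a b w) /\
  (forall eps, eps > 0 -> exists M, forall a b w,
      a <= - M -> M <= b -> is_RInt f a b w -> Rabs (w - v) < eps).

Fixpoint is_int_Rn (d : nat) : (Rn d -> R) -> R -> Prop :=
  match d return (Rn d -> R) -> R -> Prop with
  | O => fun f v => f tt = v
  | S n => fun f v => exists g : R -> R,
      (forall y1, is_int_Rn n (fun y => f (y1, y)) (g y1)) /\ is_RInt_R g v
  end.

Definition Cb (d : nat) (T : R) (u : R -> Rn d -> R) : Prop :=
  (exists C, forall t x, 0 <= t <= T -> Rabs (u t x) <= C) /\
  (forall t x, 0 <= t <= T -> forall eps, eps > 0 -> exists delta, delta > 0 /\
     forall t' x', 0 <= t' <= T -> Rabs (t' - t) < delta -> Rn_dist d x' x < delta ->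
       Rabs (u t' x' - u t x) < eps).

Definition mild_eq (d : nat) (f : R -> R) (u z : R -> Rn d -> R) (t : R) (x : Rn d) : Prop :=
  exists h : R -> R,
    (forall s, 0 <= s < t ->
       is_int_Rn d (fun y => G d (t - s) (Rn_sub d x y) * f (u s y)) (h s)) /\
    is_RInt h 0 t (u t x - z t x).

(* Main.v *)
(* Write [P] for the heat semigroup, realised as a Gaussian average
   [P_t g x = E g (x + sqrt t xi)], and [K F (t) = int_0^t P_(t-s) F(s) ds].
   If [V = K F], the semigroup law gives, for every [L],
   [V(t) = int_0^t exp (- L (t - s)) P_(t-s) (F + L V)(s) ds].
   When [F + L V] is bounded by [(kappa + L) |V| + eps], positivity of [P] and a
   weighted supremum yield [|V| <= eps exp ((kappa + 1) t)] independently of [L].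
   Applied to two solutions of [V = K g (V + z)] with Lipschitz [g] of one-sided
   constant [kappa], this is stability with respect to [g] that does not see the
   Lipschitz constant. Hence, after truncating [f], the Picard solutions for its
   Steklov averages form a uniform Cauchy sequence; the limit solves the equation,
   and the same estimate, compared with [V = 0], shows that the truncation is not
   felt. The normalising constant of [G] only rescales [f], so the value of the
   Gaussian integral is never needed. *)

From Stdlib Require Import Reals Lra Lia Classical ClassicalEpsilon FunctionalExtensionality.
From Coquelicot Require Import Coquelicot.
Require Import Defs.
Open Scope R_scope.

(** * Continuous maps and Riemann integrals *)

(** The one-sided bound lets [f] decrease arbitrarily steeply, so no contraction is available, and
    boundedness on the whole space gives no compactness for a Schauder argument. What the bound does
    give: once [g] is Lipschitz with constant [L], its difference quotients lie between [- L] and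
    [kappa], so [g + L id] is Lipschitz with constant [kappa + L], and damping the semigroup at rate
    [L] pays for exactly the added [L]. Lipschitz approximations are therefore needed to run the
    estimate, although their constants cancel from it.

    The Gaussian average is preferred to the kernel because [sqrt (t - s)] is continuous up to
    [s = t], where [G] is singular: every time integrand is then continuous and Riemann integration
    suffices. The semigroup law becomes additivity of variances for independent Gaussians, that is,
    rotation invariance in the plane. Time is clamped to [[0, T]] so that the data and the iterates
    are bounded and continuous on all of [R * Rn d] and no subspace has to be carried along. *)

Definition cts {X Y : UniformSpace} (f : X -> Y) : Prop := forall x, continuous f x.

Lemma cts_comp {X Y Z : UniformSpace} (f : Y -> Z) (g : X -> Y) :
  cts f -> cts g -> cts (fun x => f (g x)).
Proof. intros Hf Hg x; apply (continuous_comp g f x); [apply Hg | apply Hf]. Qed.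

Lemma cts_pair {X Y Z : UniformSpace} (f : X -> Y) (g : X -> Z) :
  cts f -> cts g -> cts (Y := prod_UniformSpace Y Z) (fun x => (f x, g x)).
Proof.
  intros Hf Hg x.
  apply (continuous_comp_2 f g (fun a b => (a, b)) x (Hf x) (Hg x)).
  apply continuous_ext with (fun p => p); [now intros [a b] | apply continuous_id].
Qed.

Lemma cts_fst {X Y : UniformSpace} : cts (X := prod_UniformSpace X Y) (@fst X Y).
Proof. intros [a b]; apply continuous_fst. Qed.

Lemma cts_snd {X Y : UniformSpace} : cts (X := prod_UniformSpace X Y) (@snd X Y).
Proof. intros [a b]; apply continuous_snd. Qed.

Lemma cts_id {X : UniformSpace} : cts (fun x : X => x).
Proof. intros x; apply continuous_id. Qed.

Lemma cts_const {X Y : UniformSpace} (c : Y) : cts (fun _ : X => c).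
Proof. intros x; apply continuous_const. Qed.

Lemma cts_eps {X : UniformSpace} (f : X -> R) :
  cts f <-> forall x eps, 0 < eps ->
    exists delta : posreal, forall y, ball x delta y -> Rabs (f y - f x) < eps.
Proof.
  split.
  - intros Hf x eps He.
    destruct (proj1 (filterlim_locally _ _) (Hf x) (mkposreal eps He)) as [de Hde].
    exists de; intros y Hy; exact (Hde y Hy).
  - intros H x; apply filterlim_locally; intros eps.
    destruct (H x eps (cond_pos eps)) as [de Hde].
    exists de; intros y Hy; exact (Hde y Hy).
Qed.

Lemma cts_plus {X : UniformSpace} (f g : X -> R) :
  cts f -> cts g -> cts (fun x => f x + g x).
Proof. intros Hf Hg x; apply (continuous_plus f g x); [apply Hf | apply Hg]. Qed.

Lemma cts_minus {X : UniformSpace} (f g : X -> R) :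
  cts f -> cts g -> cts (fun x => f x - g x).
Proof. intros Hf Hg x; apply (continuous_minus f g x); [apply Hf | apply Hg]. Qed.

Lemma cts_mult {X : UniformSpace} (f g : X -> R) :
  cts f -> cts g -> cts (fun x => f x * g x).
Proof. intros Hf Hg x; apply (continuous_mult f g x); [apply Hf | apply Hg]. Qed.

Lemma cts_continuity (f : R -> R) : continuity f <-> cts f.
Proof.
  split; intros H x; apply continuity_pt_filterlim, H.
Qed.

Lemma cts_exp : cts exp.
Proof. apply cts_continuity, derivable_continuous, derivable_exp. Qed.

Lemma cts_sqrt : cts sqrt.
Proof. intros x; apply continuous_sqrt. Qed.

Lemma cts_slice {X Y Z : UniformSpace} (f : X * Y -> Z) (x : X) :
  cts (X := prod_UniformSpace X Y) f -> cts (fun y => f (x, y)).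
Proof.
  intros Hf; apply (cts_comp (Y := prod_UniformSpace X Y) f (fun y => (x, y)) Hf).
  apply cts_pair; [apply cts_const | apply cts_id].
Qed.

Lemma ex_RInt_cts (f : R -> R) a b : cts f -> ex_RInt f a b.
Proof. intros Hf; apply (ex_RInt_continuous f a b); intros; apply Hf. Qed.

Lemma cts_unif_lim {X : UniformSpace} (f : X -> R) :
  (forall eps, 0 < eps -> exists g : X -> R, cts g /\ forall x, Rabs (f x - g x) <= eps) -> cts f.
Proof.
  intros H; apply cts_eps; intros x eps He.
  destruct (H (eps / 4) ltac:(lra)) as [g [Hg Hfg]].
  destruct (proj1 (cts_eps g) Hg x (eps / 4) ltac:(lra)) as [de Hde].
  exists de; intros y Hy.
  generalize (Hde y Hy) (Hfg x) (Hfg y).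
  unfold Rabs; repeat destruct Rcase_abs; lra.
Qed.

Lemma Rabs_RInt_le (f : R -> R) a b M :
  cts f -> (forall t, Rmin a b <= t <= Rmax a b -> Rabs (f t) <= M) ->
  Rabs (RInt f a b) <= Rabs (b - a) * M.
Proof.
  intros Hf HM; destruct (Rle_dec a b) as [Hab | Hab].
  - rewrite Rmin_left, Rmax_right in HM by lra.
    rewrite (Rabs_pos_eq (b - a)) by lra.
    apply abs_RInt_le_const; auto using ex_RInt_cts.
  - rewrite Rmin_right, Rmax_left in HM by lra.
    replace (RInt f a b) with (- RInt f b a) by (apply (opp_RInt_swap f), ex_RInt_cts, Hf).
    rewrite Rabs_Ropp, Rabs_minus_sym, (Rabs_pos_eq (a - b)) by lra.
    apply abs_RInt_le_const; auto using ex_RInt_cts; lra.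
Qed.

Lemma RInt_minus_cts (f g : R -> R) a b :
  cts f -> cts g -> RInt (fun t => f t - g t) a b = RInt f a b - RInt g a b.
Proof. intros; apply (RInt_minus f g); apply ex_RInt_cts; assumption. Qed.

Lemma RInt_plus_cts (f g : R -> R) a b :
  cts f -> cts g -> RInt (fun t => f t + g t) a b = RInt f a b + RInt g a b.
Proof. intros; apply (RInt_plus f g); apply ex_RInt_cts; assumption. Qed.

Lemma RInt_scal_cts (c : R) (f : R -> R) a b :
  cts f -> RInt (fun t => c * f t) a b = c * RInt f a b.
Proof. intros; apply (RInt_scal f); apply ex_RInt_cts; assumption. Qed.

Lemma RInt_le_cts (f g : R -> R) a b :
  a <= b -> cts f -> cts g -> (forall t, a <= t <= b -> f t <= g t) -> RInt f a b <= RInt g a b.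
Proof. intros Hab Hf Hg H; apply RInt_le; auto using ex_RInt_cts; intros; apply H; lra. Qed.

(** Tube lemma: compactness of [[a, b]] turns the pointwise radii into one radius valid for all [r].
    It serves continuity of parameter integrals and, later, a Heine-Cantor argument. *)
Lemma cts_tube {X : UniformSpace} (F : X * R -> R) (p : X) a b eps :
  cts (X := prod_UniformSpace X R_UniformSpace) F -> 0 < eps ->
  exists delta : posreal, forall q r, ball p delta q -> a <= r <= b ->
    Rabs (F (q, r) - F (p, r)) < eps.
Proof.
  intros HF He.
  assert (Hd : forall r, exists de : posreal, forall q r', ball p de q -> Rabs (r' - r) < de ->
     Rabs (F (q, r') - F (p, r)) < eps / 2).
  { intros r; destruct (proj1 (cts_eps F) HF (p, r) (eps / 2) ltac:(lra)) as [de Hde].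
    exists de; intros q r' Hq Hr; apply Hde; split; assumption. }
  set (de := fun r => proj1_sig (constructive_indefinite_description _ (Hd r))).
  assert (Hde : forall r q r', ball p (de r) q -> Rabs (r' - r) < de r ->
     Rabs (F (q, r') - F (p, r)) < eps / 2).
  { intros r; unfold de; destruct constructive_indefinite_description; assumption. }
  destruct (compactness_value_1d a b de) as [d Hd'].
  exists d; intros q r Hq Hr.
  (* The compactness lemma delivers the covering point only under a double negation. *)
  destruct (NNPP _ (Hd' r Hr)) as [t [Ht [Hrt Hdt]]].
  generalize (Hde t q r (ball_le p _ _ Hdt q Hq) Hrt) (Hde t p r (ball_center p (de t)) Hrt).
  unfold Rabs; repeat destruct Rcase_abs; lra.
Qed.

Lemma cts_RInt_param {X : UniformSpace} (F : X * R -> R) a b :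
  cts (X := prod_UniformSpace X R_UniformSpace) F ->
  cts (fun p => RInt (fun r => F (p, r)) a b).
Proof.
  intros HF; apply cts_eps; intros p eps He.
  (* The summand 1 keeps the division by [l] legitimate when [a = b]. *)
  set (l := 1 + Rabs (b - a)).
  assert (Hl : 0 < l) by (unfold l; generalize (Rabs_pos (b - a)); lra).
  destruct (cts_tube F p (Rmin a b) (Rmax a b) (eps / l) HF) as [de Hde].
  { apply Rdiv_lt_0_compat; lra. }
  exists de; intros q Hq.
  rewrite <- RInt_minus_cts by (apply (cts_slice F); assumption).
  apply Rle_lt_trans with (Rabs (b - a) * (eps / l)).
  - apply Rabs_RInt_le.
    + apply cts_minus; apply (cts_slice F); assumption.
    + intros t Ht; left; apply Hde; assumption.
  - apply Rlt_le_trans with (l * (eps / l)); [| right; field; lra].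
    apply Rmult_lt_compat_r; [apply Rdiv_lt_0_compat; lra | unfold l; lra].
Qed.

Lemma is_derive_RInt_cts (f : R -> R) a x :
  cts f -> is_derive (fun t => RInt f a t) x (f x).
Proof.
  intros Hf; apply (is_derive_RInt f (fun t => RInt f a t) a); [| apply Hf].
  exists (mkposreal 1 Rlt_0_1); intros y _; apply (RInt_correct f), ex_RInt_cts, Hf.
Qed.

Lemma cts_swap {X Y Z : UniformSpace} (f : X * Y -> Z) :
  cts (X := prod_UniformSpace X Y) f ->
  cts (X := prod_UniformSpace Y X) (fun p => f (snd p, fst p)).
Proof.
  intros Hf; apply (cts_comp (X := prod_UniformSpace Y X) (Y := prod_UniformSpace X Y) f
    (fun p => (snd p, fst p)) Hf), cts_pair; [apply cts_snd | apply cts_fst].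
Qed.

(* Both sides, as functions of the upper bound [d], have the same derivative. *)
Lemma RInt_Fubini (F : R * R -> R) a b c d :
  cts (X := prod_UniformSpace R_UniformSpace R_UniformSpace) F ->
  RInt (fun s => RInt (fun r => F (s, r)) a b) c d =
  RInt (fun r => RInt (fun s => F (s, r)) c d) a b.
Proof.
  intros HF.
  assert (HD : forall u v, is_derive (fun z => RInt (fun s => F (s, v)) c z) u (F (u, v))).
  { intros u v; apply (is_derive_RInt_cts (fun s => F (s, v))).
    apply (cts_slice (fun p => F (snd p, fst p)) v), cts_swap, HF. }
  assert (HG : cts (fun s => RInt (fun r => F (s, r)) a b)) by (apply cts_RInt_param, HF).
  assert (HC : forall y, cts (fun t => RInt (fun s => F (s, t)) c y)).
  { intros y; apply (cts_RInt_param (fun p => F (snd p, fst p))), cts_swap, HF. }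
  set (A := fun t => RInt (fun s => RInt (fun r => F (s, r)) a b) c t).
  set (B := fun t => RInt (fun r => RInt (fun s => F (s, r)) c t) a b).
  assert (HA : forall t, is_derive A t (RInt (fun r => F (t, r)) a b)).
  { intros t; apply (is_derive_RInt_cts (fun s => RInt (fun r => F (s, r)) a b)), HG. }
  assert (HB : forall t, is_derive B t (RInt (fun r => F (t, r)) a b)).
  { intros t.
    replace (RInt (fun r => F (t, r)) a b)
      with (RInt (fun r => Derive (fun u => RInt (fun s => F (s, r)) c u) t) a b).
    2: { apply RInt_ext; intros r _; apply is_derive_unique, HD. }
    apply (is_derive_RInt_param (fun u r => RInt (fun s => F (s, r)) c u)).
    - exists (mkposreal 1 Rlt_0_1); intros y _ r _; eexists; apply HD.
    - intros r _.
      apply continuity_2d_pt_ext with (fun u v => F (u, v)).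
      + intros u v; symmetry; apply is_derive_unique, HD.
      + apply continuity_2d_pt_filterlim.
        apply (filterlim_ext (fun z => F z)); [now intros [u v] |]. apply HF.
    - exists (mkposreal 1 Rlt_0_1); intros y _; apply ex_RInt_cts, HC. }
  assert (Hc : A c = B c).
  { unfold A, B; rewrite RInt_point.
    rewrite (RInt_ext _ (fun _ => 0)) by (intros; rewrite RInt_point; reflexivity).
    rewrite RInt_const; unfold zero, scal; simpl; unfold mult; simpl; ring. }
  assert (H0 : forall t, is_derive (fun t => A t - B t) t 0).
  { intros t; replace 0 with (minus (RInt (fun r => F (t, r)) a b) (RInt (fun r => F (t, r)) a b)).
    - apply (is_derive_minus A B); auto.
    - unfold minus, plus, opp; simpl; ring. }
  change (A d = B d).
  enough (A d - B d = A c - B c) by lra.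
  destruct (MVT_gen (fun t => A t - B t) c d (fun _ => 0)) as [m [_ Hm]].
  - intros; apply H0.
  - intros x _; apply continuity_pt_filterlim.
    apply (ex_derive_continuous (fun t => A t - B t)); eexists; apply H0.
  - lra.
Qed.

(** * The one-dimensional Gaussian functional *)

Definition gphi (x : R) : R := exp (- (x * x) / 2).

Lemma cts_gphi : cts gphi.
Proof.
  unfold gphi; apply (cts_comp exp (fun x => - (x * x) / 2) cts_exp).
  intros x; apply (ex_derive_continuous (fun x => - (x * x) / 2)); auto_derive; auto.
Qed.

Lemma gphi_pos x : 0 < gphi x.
Proof. apply exp_pos. Qed.

Lemma gphi_le_1 x : gphi x <= 1.
Proof.
  unfold gphi; rewrite <- exp_0; destruct (Req_dec x 0) as [-> |].
  - right; f_equal; field.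
  - left; apply exp_increasing; nra.
Qed.

(** From [exp y >= 1 + y] at [y = x^2 / 2]. This crude quadratic decay is integrable with an
    explicit primitive, which is all the tail estimates require. *)
Lemma gphi_tail x : x <> 0 -> gphi x <= 2 / (x * x).
Proof.
  intros Hx; unfold gphi.
  replace (- (x * x) / 2) with (- (x * x / 2)) by field.
  rewrite exp_Ropp; assert (0 < x * x) by nra.
  replace (2 / (x * x)) with (/ (x * x / 2)) by (field; lra).
  apply Rinv_le_contravar; [lra |].
  generalize (exp_ineq1_le (x * x / 2)); lra.
Qed.

Lemma cts_gphi_mult (k : R -> R) : cts k -> cts (fun r => gphi r * k r).
Proof. intros; apply cts_mult; [apply cts_gphi | assumption]. Qed.

(** Integrates the majorant [2 B / r^2], whose primitive is [- 2 B / r]; the condition [0 < a * b]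
    keeps the origin out of the interval. *)
Lemma RInt_gphi_tail_le (k : R -> R) B a b :
  cts k -> (forall r, Rabs (k r) <= B) -> a <= b -> 0 < a * b ->
  Rabs (RInt (fun r => gphi r * k r) a b) <= 2 * B * (/ a - / b).
Proof.
  intros Hk HB Hab H0.
  assert (Hnz : forall x, a <= x <= b -> x <> 0) by (intros x Hx ->; nra).
  assert (Hc := cts_gphi_mult k Hk).
  assert (HB0 : 0 <= B) by (generalize (HB 0) (Rabs_pos (k 0)); lra).
  assert (HI : RInt.is_RInt (fun r => 2 * B * / (r * r)) a b (2 * B * (/ a - / b))).
  { replace (2 * B * (/ a - / b)) with (minus ((fun r => - (2 * B) * / r) b) ((fun r => - (2 * B) * / r) a))
      by (unfold minus, plus, opp; simpl; ring).
    apply (is_RInt_derive (fun r => - (2 * B) * / r) (fun r => 2 * B * / (r * r)));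
      rewrite Rmin_left, Rmax_right by lra; intros x Hx; specialize (Hnz x Hx).
    - auto_derive; [assumption | field; assumption].
    - apply (ex_derive_continuous (fun r => 2 * B * / (r * r))); auto_derive; nra. }
  rewrite <- (is_RInt_unique _ _ _ _ HI).
  eapply Rle_trans; [apply abs_RInt_le; [assumption | apply ex_RInt_cts, Hc] |].
  apply RInt_le; [assumption | | eexists; apply HI |].
  - apply ex_RInt_cts; apply (cts_comp Rabs _); [intros x; apply continuous_Rabs | exact Hc].
  - intros x Hx; rewrite Rabs_mult, (Rabs_pos_eq (gphi x)) by (left; apply gphi_pos).
    generalize (gphi_tail x (Hnz x ltac:(lra))) (HB x) (Rabs_pos (k x)) (gphi_pos x); unfold Rdiv; intros.
    apply Rle_trans with ((2 * / (x * x)) * B); [apply Rmult_le_compat; lra | lra].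
Qed.

Lemma RInt_gphi_tail (k : R -> R) B N a b :
  cts k -> (forall r, Rabs (k r) <= B) -> 0 < N ->
  (N <= a /\ N <= b) \/ (a <= - N /\ b <= - N) ->
  Rabs (RInt (fun r => gphi r * k r) a b) <= 2 * B / N.
Proof.
  intros Hk HB HN.
  assert (HB0 : 0 <= B) by (generalize (HB 0) (Rabs_pos (k 0)); lra).
  assert (Hord : forall a b, (N <= a /\ N <= b) \/ (a <= - N /\ b <= - N) -> a <= b ->
    Rabs (RInt (fun r => gphi r * k r) a b) <= 2 * B / N).
  { clear a b; intros a b H Hab; eapply Rle_trans; [apply (RInt_gphi_tail_le k B); auto; nra |].
    unfold Rdiv; apply Rmult_le_compat_l; [lra |].
    destruct H as [[Ha Hb] | [Ha Hb]].
    - assert (0 < / b) by (apply Rinv_0_lt_compat; lra).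
      assert (/ a <= / N) by (apply Rinv_le_contravar; lra); lra.
    - assert (/ a < 0) by (apply Rinv_lt_0_compat; lra).
      assert (/ - b <= / N) by (apply Rinv_le_contravar; lra).
      rewrite Rinv_opp in H0; lra. }
  intros H; destruct (Rle_dec a b) as [Hab | Hab]; [auto |].
  rewrite <- (opp_RInt_swap (fun r => gphi r * k r)) by apply ex_RInt_cts, cts_gphi_mult, Hk.
  unfold opp; simpl; rewrite Rabs_Ropp; apply Hord; [tauto | lra].
Qed.

Lemma RInt_gphi_diff (k : R -> R) B N a b a' b' :
  cts k -> (forall r, Rabs (k r) <= B) -> 0 < N ->
  a <= - N -> N <= b -> a' <= - N -> N <= b' ->
  Rabs (RInt (fun r => gphi r * k r) a b - RInt (fun r => gphi r * k r) a' b') <= 4 * B / N.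
Proof.
  intros Hk HB HN Ha Hb Ha' Hb'.
  set (h := fun r => gphi r * k r).
  assert (Hh : cts h) by (apply cts_gphi_mult, Hk).
  assert (E1 : RInt h a b = RInt h a a' + RInt h a' b).
  { symmetry; apply (RInt_Chasles h); apply ex_RInt_cts, Hh. }
  assert (E2 : RInt h a' b = RInt h a' b' + RInt h b' b).
  { symmetry; apply (RInt_Chasles h); apply ex_RInt_cts, Hh. }
  rewrite E1, E2.
  replace (RInt h a a' + (RInt h a' b' + RInt h b' b) - RInt h a' b') with (RInt h a a' + RInt h b' b) by ring.
  eapply Rle_trans; [apply Rabs_triang |].
  generalize (RInt_gphi_tail k B N a a' Hk HB HN ltac:(lra))
             (RInt_gphi_tail k B N b' b Hk HB HN ltac:(lra)); fold h.
  unfold Rdiv; lra.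
Qed.

(** The unnormalised Gaussian integral. Taking a limit over [[- n, n]] makes it a total function, so
    that it can be iterated and rewritten freely; for bounded continuous [k] the limit is genuine by
    [gint_lim]. *)
Definition gint (k : R -> R) : R :=
  real (Lim_seq (fun n => RInt (fun r => gphi r * k r) (- INR n) (INR n))).

Definition bnd {X : Type} (k : X -> R) : Prop := exists B, forall x, Rabs (k x) <= B.

Lemma small_tail C eps : 0 < eps -> exists N, 0 < N /\ C / N < eps.
Proof.
  intros He; exists (Rabs C / eps + 1).
  assert (0 <= Rabs C / eps) by (apply Rdiv_le_0_compat; [apply Rabs_pos | lra]).
  split; [lra |].
  apply Rmult_lt_reg_r with (Rabs C / eps + 1); [lra |].
  unfold Rdiv at 1; rewrite Rmult_assoc, Rinv_l, Rmult_1_r by lra.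
  apply Rle_lt_trans with (Rabs C); [apply Rle_abs |].
  rewrite Rmult_plus_distr_l; unfold Rdiv.
  rewrite <- Rmult_assoc, (Rmult_comm eps), Rmult_assoc, Rinv_r; lra.
Qed.

Lemma gint_lim (k : R -> R) : cts k -> bnd k ->
  is_lim_seq (fun n => RInt (fun r => gphi r * k r) (- INR n) (INR n)) (gint k).
Proof.
  intros Hk [B HB]; apply Lim_seq_correct', ex_lim_seq_cauchy_corr.
  intros eps; destruct (small_tail (4 * B) eps (cond_pos eps)) as [N [HN HN']].
  destruct (nfloor_ex N ltac:(lra)) as [n0 Hn0].
  (* The floor [n0] may lie below [N]; its successor does not. *)
  exists (S n0); intros n m Hn Hm.
  apply le_INR in Hn, Hm; rewrite S_INR in Hn, Hm.
  eapply Rle_lt_trans; [| exact HN'].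
  apply RInt_gphi_diff; auto; lra.
Qed.

(** The rate depends on [k] only through its bound [B], hence is uniform in any parameter. It takes
    the place of dominated convergence in every limit exchange below. *)
Lemma gint_tail (k : R -> R) B N a b :
  cts k -> (forall r, Rabs (k r) <= B) -> 0 < N -> a <= - N -> N <= b ->
  Rabs (RInt (fun r => gphi r * k r) a b - gint k) <= 4 * B / N.
Proof.
  intros Hk HB HN Ha Hb.
  set (u := fun n => Rabs (RInt (fun r => gphi r * k r) a b - RInt (fun r => gphi r * k r) (- INR n) (INR n))).
  assert (Hu : is_lim_seq u (Rabs (RInt (fun r => gphi r * k r) a b - gint k))).
  { unfold u; apply (is_lim_seq_abs _ (Finite _)), is_lim_seq_minus'.
    - apply is_lim_seq_const.
    - apply gint_lim; [assumption | exists B; assumption]. }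
  refine (is_lim_seq_le_loc u (fun _ => 4 * B / N) (Finite _) (Finite _) _ Hu (is_lim_seq_const _)).
  destruct (nfloor_ex N ltac:(lra)) as [n0 Hn0].
  exists (S n0); intros n Hn; apply le_INR in Hn; rewrite S_INR in Hn.
  apply RInt_gphi_diff; auto; lra.
Qed.

Lemma eq_of_small x y : (forall eps, 0 < eps -> Rabs (x - y) <= eps) -> x = y.
Proof.
  intros H; apply NNPP; intros Hn.
  assert (0 < Rabs (x - y)) by (apply Rabs_pos_lt; lra).
  generalize (H (Rabs (x - y) / 2) ltac:(lra)); lra.
Qed.

(** Used to evaluate a Gaussian integral by computing its truncations, where Fubini and substitution
    on compact intervals are available. *)
Lemma gint_charac (k : R -> R) v : cts k -> bnd k ->
  (forall eps, 0 < eps -> exists M, forall N, M <= N ->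
     Rabs (RInt (fun r => gphi r * k r) (- N) N - v) <= eps) ->
  gint k = v.
Proof.
  intros Hk [B HB] Hv; apply eq_of_small; intros eps He.
  destruct (small_tail (4 * B) (eps / 2) ltac:(lra)) as [N [HN HN']].
  destruct (Hv (eps / 2) ltac:(lra)) as [M HM].
  set (N' := Rmax N M).
  generalize (HM N' (Rmax_r _ _)) (gint_tail k B N (- N') N' Hk HB HN
    ltac:(unfold N'; generalize (Rmax_l N M); lra) ltac:(unfold N'; generalize (Rmax_l N M); lra)).
  unfold Rabs; repeat destruct Rcase_abs; lra.
Qed.

Lemma bnd_const {X : Type} (c : R) : bnd (fun _ : X => c).
Proof. exists (Rabs c); intros; lra. Qed.

Lemma bnd_plus {X : Type} (f g : X -> R) : bnd f -> bnd g -> bnd (fun x => f x + g x).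
Proof.
  intros [A HA] [B HB]; exists (A + B); intros x.
  eapply Rle_trans; [apply Rabs_triang | generalize (HA x) (HB x); lra].
Qed.

Lemma bnd_mult {X : Type} (f g : X -> R) : bnd f -> bnd g -> bnd (fun x => f x * g x).
Proof.
  intros [A HA] [B HB]; exists (A * B); intros x; rewrite Rabs_mult.
  apply Rmult_le_compat; auto using Rabs_pos.
Qed.

Lemma bnd_comp {X Y : Type} (f : Y -> R) (g : X -> Y) : bnd f -> bnd (fun x => f (g x)).
Proof. intros [B HB]; exists B; auto. Qed.

Lemma bnd_gphi : bnd gphi.
Proof.
  exists 1; intros x; rewrite Rabs_pos_eq; [apply gphi_le_1 | left; apply gphi_pos].
Qed.

Lemma gint_plus (k l : R -> R) : cts k -> cts l -> bnd k -> bnd l ->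
  gint (fun r => k r + l r) = gint k + gint l.
Proof.
  intros Hk Hl Bk Bl.
  assert (H := gint_lim _ (cts_plus _ _ Hk Hl) (bnd_plus _ _ Bk Bl)).
  assert (H' := is_lim_seq_plus' _ _ _ _ (gint_lim k Hk Bk) (gint_lim l Hl Bl)).
  apply is_lim_seq_unique in H, H'.
  enough (Finite (gint (fun r => k r + l r)) = Finite (gint k + gint l)) by congruence.
  refine (eq_trans (eq_sym H) (eq_trans _ H')); apply Lim_seq_ext; intros n.
  rewrite <- RInt_plus_cts by (apply cts_gphi_mult; assumption).
  apply RInt_ext; intros; simpl; ring.
Qed.

Lemma gint_scal (c : R) (k : R -> R) : cts k -> bnd k ->
  gint (fun r => c * k r) = c * gint k.
Proof.
  intros Hk Bk.
  assert (H := gint_lim _ (cts_mult _ _ (cts_const c) Hk) (bnd_mult _ _ (bnd_const c) Bk)).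
  assert (H' := is_lim_seq_scal_l _ c _ (gint_lim k Hk Bk)).
  apply is_lim_seq_unique in H, H'.
  enough (Finite (gint (fun r => c * k r)) = Finite (c * gint k)) by congruence.
  refine (eq_trans (eq_sym H) (eq_trans _ H')); apply Lim_seq_ext; intros n.
  rewrite <- RInt_scal_cts by (apply cts_gphi_mult; assumption).
  apply RInt_ext; intros; simpl; ring.
Qed.

Lemma RInt_gphi_le_gint a b : a <= b -> RInt (fun r => gphi r * 1) a b <= gint (fun _ => 1).
Proof.
  intros Hab.
  assert (Hc := cts_gphi_mult (fun _ => 1) (cts_const 1)).
  refine (is_lim_seq_le_loc _ _ (Finite _) (Finite _) _ (is_lim_seq_const _)
    (gint_lim (fun _ => 1) (cts_const 1) (bnd_const 1))).
  destruct (nfloor_ex (Rabs a + Rabs b)) as [n0 Hn0].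
  { generalize (Rabs_pos a) (Rabs_pos b); lra. }
  exists (S n0); intros n Hn; apply le_INR in Hn; rewrite S_INR in Hn.
  assert (- INR n <= a /\ b <= INR n).
  { destruct Hn0 as [_ Hn0]; revert Hn0; unfold Rabs; repeat destruct Rcase_abs; lra. }
  set (h := fun r => gphi r * 1) in *.
  assert (E1 : RInt h (- INR n) (INR n) = RInt h (- INR n) a + RInt h a (INR n)).
  { symmetry; apply (RInt_Chasles h); apply ex_RInt_cts, Hc. }
  assert (E2 : RInt h a (INR n) = RInt h a b + RInt h b (INR n)).
  { symmetry; apply (RInt_Chasles h); apply ex_RInt_cts, Hc. }
  rewrite E1, E2.
  assert (P : forall a b, a <= b -> 0 <= RInt h a b).
  { intros a' b' Hab'; apply RInt_ge_0; [assumption | apply ex_RInt_cts, Hc |].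
    intros x _; unfold h; generalize (gphi_pos x); lra. }
  generalize (P (- INR n) a ltac:(lra)) (P b (INR n) ltac:(lra)); lra.
Qed.

Lemma gint_1_pos : 0 < gint (fun _ => 1).
Proof.
  apply Rlt_le_trans with (RInt (fun r => gphi r * 1) (- 1) 1); [| apply RInt_gphi_le_gint; lra].
  apply RInt_gt_0; [lra | | intros; apply (cts_gphi_mult (fun _ => 1)), cts_const].
  intros; rewrite Rmult_1_r; apply gphi_pos.
Qed.

Lemma RInt_gphi_abs (k : R -> R) B a b : cts k -> (forall r, Rabs (k r) <= B) -> a <= b ->
  Rabs (RInt (fun r => gphi r * k r) a b) <= B * RInt (fun r => gphi r * 1) a b.
Proof.
  intros Hk HB Hab.
  assert (Hc := cts_gphi_mult _ Hk).
  eapply Rle_trans; [apply abs_RInt_le; auto using ex_RInt_cts |].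
  rewrite <- RInt_scal_cts by (apply cts_gphi_mult, cts_const).
  apply RInt_le_cts; auto.
  - apply (cts_comp Rabs _); [intros x; apply continuous_Rabs | exact Hc].
  - apply cts_mult; [apply cts_const | apply cts_gphi_mult, cts_const].
  - intros t _; rewrite Rabs_mult, (Rabs_pos_eq (gphi t)) by (left; apply gphi_pos).
    generalize (gphi_pos t) (HB t); nra.
Qed.

Lemma gint_abs (k : R -> R) B : cts k -> (forall r, Rabs (k r) <= B) ->
  Rabs (gint k) <= B * gint (fun _ => 1).
Proof.
  intros Hk HB.
  assert (H := is_lim_seq_abs _ _ (gint_lim k Hk (ex_intro _ B HB))).
  assert (H' := is_lim_seq_scal_l _ B _ (gint_lim (fun _ => 1) (cts_const 1) (bnd_const 1))).
  refine (is_lim_seq_le _ _ (Finite _) (Finite _) _ H H'); intros n.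
  apply RInt_gphi_abs; auto; generalize (pos_INR n); lra.
Qed.

Definition gauss (k : R -> R) : R := gint k / gint (fun _ => 1).

Lemma gauss_const c : gauss (fun _ => c) = c.
Proof.
  unfold gauss; replace (fun _ : R => c) with (fun _ : R => c * 1)
    by (apply functional_extensionality; intros; ring).
  rewrite (gint_scal c (fun _ => 1)) by (apply cts_const || apply bnd_const).
  field; apply Rgt_not_eq, gint_1_pos.
Qed.

Lemma gauss_plus (k l : R -> R) : cts k -> cts l -> bnd k -> bnd l ->
  gauss (fun r => k r + l r) = gauss k + gauss l.
Proof. intros; unfold gauss; rewrite gint_plus by assumption; unfold Rdiv; ring. Qed.

Lemma gauss_scal (c : R) (k : R -> R) : cts k -> bnd k ->
  gauss (fun r => c * k r) = c * gauss k.
Proof. intros; unfold gauss; rewrite gint_scal by assumption; unfold Rdiv; ring. Qed.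

Lemma gauss_abs (k : R -> R) B : cts k -> (forall r, Rabs (k r) <= B) -> Rabs (gauss k) <= B.
Proof.
  intros Hk HB; generalize gint_1_pos (gint_abs k B Hk HB); intros Hp H.
  unfold gauss, Rdiv; rewrite Rabs_mult, (Rabs_pos_eq (/ _)) by (left; apply Rinv_0_lt_compat, Hp).
  apply Rmult_le_reg_r with (gint (fun _ => 1)); [assumption |].
  rewrite Rmult_assoc, Rinv_l, Rmult_1_r by lra; assumption.
Qed.

(** * Dependence on parameters and exchange of integrals *)

(** A uniform limit of integrals over [[- N, N]]: the tail rate does not depend on the parameter
    [p]. *)
Lemma cts_gint {X : UniformSpace} (F : X * R -> R) :
  cts (X := prod_UniformSpace X R_UniformSpace) F -> bnd F ->
  cts (fun p => gint (fun r => F (p, r))).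
Proof.
  intros HF [B HB]; apply cts_unif_lim; intros eps He.
  destruct (small_tail (4 * B) eps He) as [N [HN HN']].
  exists (fun p => RInt (fun r => gphi r * F (p, r)) (- N) N); split.
  - apply (cts_RInt_param (fun q => gphi (snd q) * F q)).
    apply cts_mult; [apply (cts_comp (X := prod_UniformSpace X R_UniformSpace) gphi snd cts_gphi), cts_snd | exact HF].
  - intros p; rewrite Rabs_minus_sym; left; eapply Rle_lt_trans; [| exact HN'].
    apply gint_tail; auto using cts_slice; lra.
Qed.

Lemma cts_gauss {X : UniformSpace} (F : X * R -> R) :
  cts (X := prod_UniformSpace X R_UniformSpace) F -> bnd F ->
  cts (fun p => gauss (fun r => F (p, r))).
Proof.
  intros; unfold gauss, Rdiv; apply cts_mult; [apply cts_gint; assumption | apply cts_const].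
Qed.

Lemma cts_slice_l {X Y Z : UniformSpace} (f : X * Y -> Z) (y : Y) :
  cts (X := prod_UniformSpace X Y) f -> cts (fun x => f (x, y)).
Proof. intros Hf; apply (cts_slice (fun p => f (snd p, fst p)) y), cts_swap, Hf. Qed.

Lemma bnd_RInt (F : R * R -> R) a b B :
  cts (X := prod_UniformSpace R_UniformSpace R_UniformSpace) F -> (forall p, Rabs (F p) <= B) ->
  forall r, Rabs (RInt (fun s => F (s, r)) a b) <= Rabs (b - a) * B.
Proof. intros HF HB r; apply Rabs_RInt_le; auto; apply cts_slice_l, HF. Qed.

(** On [[- N, N]] this is Fubini for two compact intervals; the truncation error is [4 B / N0] for
    each [s], so it stays small after integration over the bounded range of [s]. *)
Lemma gint_RInt (F : R * R -> R) a b :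
  cts (X := prod_UniformSpace R_UniformSpace R_UniformSpace) F -> bnd F ->
  gint (fun r => RInt (fun s => F (s, r)) a b) = RInt (fun s => gint (fun r => F (s, r))) a b.
Proof.
  intros HF [B HB].
  assert (H1 : cts (fun r => RInt (fun s => F (s, r)) a b)).
  { apply (cts_RInt_param (fun p => F (snd p, fst p))), cts_swap, HF. }
  assert (H2 := bnd_RInt F a b B HF HB).
  assert (HG : cts (X := prod_UniformSpace R_UniformSpace R_UniformSpace) (fun q => gphi (snd q) * F q)).
  { apply cts_mult; [apply (cts_comp (X := prod_UniformSpace R_UniformSpace R_UniformSpace) gphi snd cts_gphi), cts_snd | exact HF]. }
  apply gint_charac; [assumption | eexists; apply H2 |].
  intros eps He.
  destruct (small_tail (Rabs (b - a) * (4 * B)) eps He) as [N0 [HN0 HN0']].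
  exists N0; intros N HN.
  replace (RInt (fun r => gphi r * RInt (fun s => F (s, r)) a b) (- N) N)
    with (RInt (fun s => RInt (fun r => gphi r * F (s, r)) (- N) N) a b).
  2: { rewrite (RInt_Fubini (fun q => gphi (snd q) * F q)) by exact HG.
       apply RInt_ext; intros r _; simpl; apply (RInt_scal_cts (gphi r) (fun s => F (s, r))), cts_slice_l, HF. }
  assert (H3 : cts (fun s => RInt (fun r => gphi r * F (s, r)) (- N) N)).
  { apply (cts_RInt_param (fun q => gphi (snd q) * F q)), HG. }
  assert (H4 : cts (fun s => gint (fun r => F (s, r)))) by (apply cts_gint; [assumption | exists B; assumption]).
  rewrite <- RInt_minus_cts by assumption.
  left; eapply Rle_lt_trans; [| exact HN0'].
  unfold Rdiv; rewrite Rmult_assoc; apply Rabs_RInt_le; [apply cts_minus; assumption |].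
  intros t _; apply (gint_tail (fun r => F (t, r)) B N0); auto; try lra; apply cts_slice, HF.
Qed.

Lemma gauss_RInt (F : R * R -> R) a b :
  cts (X := prod_UniformSpace R_UniformSpace R_UniformSpace) F -> bnd F ->
  gauss (fun r => RInt (fun s => F (s, r)) a b) = RInt (fun s => gauss (fun r => F (s, r))) a b.
Proof.
  intros HF BF; unfold gauss; rewrite gint_RInt by assumption.
  unfold Rdiv; rewrite Rmult_comm, <- RInt_scal_cts by (apply cts_gint; assumption).
  apply RInt_ext; intros; simpl; ring.
Qed.

Lemma bnd_gint {X : UniformSpace} (F : X * R -> R) :
  cts (X := prod_UniformSpace X R_UniformSpace) F -> bnd F ->
  bnd (fun p => gint (fun r => F (p, r))).
Proof.
  intros HF [B HB]; eexists; intros p; apply gint_abs with (B := B); [apply cts_slice, HF | auto].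
Qed.

Lemma bnd_gauss {X : UniformSpace} (F : X * R -> R) :
  cts (X := prod_UniformSpace X R_UniformSpace) F -> bnd F ->
  bnd (fun p => gauss (fun r => F (p, r))).
Proof.
  intros HF [B HB]; exists B; intros p; apply gauss_abs; [apply cts_slice, HF | auto].
Qed.

Lemma gint_minus (k l : R -> R) : cts k -> cts l -> bnd k -> bnd l ->
  gint (fun r => k r - l r) = gint k - gint l.
Proof.
  intros Hk Hl Bk Bl.
  replace (fun r => k r - l r) with (fun r => k r + (-1) * l r)
    by (apply functional_extensionality; intros; ring).
  rewrite gint_plus, gint_scal; auto; [ring | |].
  - apply cts_mult; [apply cts_const | assumption].
  - apply bnd_mult; [apply bnd_const | assumption].
Qed.

(** Only one of the two variables is truncated. [gint_RInt] exchanges the resulting mixed integral,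
    and the error, uniform in the other variable, is multiplied by the finite total mass. *)
Lemma gint_gint (F : R * R -> R) :
  cts (X := prod_UniformSpace R_UniformSpace R_UniformSpace) F -> bnd F ->
  gint (fun q => gint (fun r => F (q, r))) = gint (fun r => gint (fun q => F (q, r))).
Proof.
  intros HF BF; symmetry; apply gint_charac.
  - apply (cts_gint (fun p => F (snd p, fst p))); [apply cts_swap, HF | apply (bnd_comp F), BF].
  - apply (bnd_gint (fun p => F (snd p, fst p))); [apply cts_swap, HF | apply (bnd_comp F), BF].
  - intros eps He; destruct BF as [B HB].
    destruct (small_tail (4 * B * gint (fun _ => 1)) eps He) as [N0 [HN0 HN0']].
    exists N0; intros N HN.
    set (H := fun p : R * R => gphi (fst p) * F (snd p, fst p)).
    assert (HH : cts (X := prod_UniformSpace R_UniformSpace R_UniformSpace) H).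
    { apply (cts_mult (X := prod_UniformSpace R_UniformSpace R_UniformSpace)
        (fun p => gphi (fst p)) (fun p => F (snd p, fst p))).
      - apply (cts_comp (X := prod_UniformSpace R_UniformSpace R_UniformSpace) gphi fst cts_gphi), cts_fst.
      - apply cts_swap, HF. }
    assert (BH : bnd H).
    { apply (bnd_mult (fun p => gphi (fst p)) (fun p => F (snd p, fst p))).
      - apply (bnd_comp gphi), bnd_gphi.
      - apply (bnd_comp F); exists B; assumption. }
    replace (RInt (fun r => gphi r * gint (fun q => F (q, r))) (- N) N)
      with (gint (fun q => RInt (fun r => gphi r * F (q, r)) (- N) N)).
    2: { rewrite (gint_RInt H) by assumption.
         apply RInt_ext; intros r _; apply (gint_scal (gphi r) (fun q => F (q, r)));
         [apply cts_slice_l, HF | exists B; auto]. }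
    assert (Hc : cts (fun q => RInt (fun r => gphi r * F (q, r)) (- N) N)).
    { apply (cts_RInt_param (fun p => H (snd p, fst p))), cts_swap, HH. }
    rewrite <- gint_minus.
    + left; eapply Rle_lt_trans; [| exact HN0'].
      replace (4 * B * gint (fun _ => 1) / N0) with (4 * B / N0 * gint (fun _ => 1)) by (field; lra).
      apply gint_abs.
      * apply cts_minus; [exact Hc | apply cts_gint; [assumption | exists B; assumption]].
      * intros q; apply (gint_tail (fun r => F (q, r))); auto; try lra; apply cts_slice, HF.
    + exact Hc.
    + apply cts_gint; [assumption | exists B; assumption].
    + destruct BH as [B' HB']; eexists; apply (bnd_RInt H _ _ B'); assumption.
    + apply bnd_gint; [assumption | exists B; assumption].
Qed.

Lemma gauss_gauss (F : R * R -> R) :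
  cts (X := prod_UniformSpace R_UniformSpace R_UniformSpace) F -> bnd F ->
  gauss (fun q => gauss (fun r => F (q, r))) = gauss (fun r => gauss (fun q => F (q, r))).
Proof.
  intros HF BF; unfold gauss; set (c := gint (fun _ => 1)).
  assert (E : forall k, cts k -> bnd k -> gint (fun q => k q / c) = gint k / c).
  { intros k Hk Bk; unfold Rdiv; rewrite (Rmult_comm (gint k)), <- gint_scal by assumption.
    f_equal; apply functional_extensionality; intros; ring. }
  rewrite !E; [rewrite gint_gint by assumption; reflexivity | ..].
  - apply (cts_gint (fun p => F (snd p, fst p))); [apply cts_swap, HF | apply (bnd_comp F), BF].
  - apply (bnd_gint (fun p => F (snd p, fst p))); [apply cts_swap, HF | apply (bnd_comp F), BF].
  - apply cts_gint; assumption.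
  - apply bnd_gint; assumption.
Qed.

Lemma cts_affine (m s : R) : cts (fun r => m + s * r).
Proof. intros x; apply (ex_derive_continuous (fun r => m + s * r)); auto_derive; auto. Qed.

Lemma RInt_gphi_affine (k : R -> R) m s a b : cts k -> 0 < s ->
  RInt (fun y => gphi ((y - m) / s) * k y) a b =
  s * RInt (fun r => gphi r * k (m + s * r)) ((a - m) / s) ((b - m) / s).
Proof.
  intros Hk Hs.
  assert (Hc : cts (fun y => gphi ((y - m) / s) * k y)).
  { apply cts_mult; [| assumption].
    apply (cts_comp gphi (fun y => (y - m) / s) cts_gphi); intros x.
    apply (ex_derive_continuous (fun y => (y - m) / s)); auto_derive; auto. }
  assert (Hc' : cts (fun r => gphi r * k (m + s * r))).
  { apply cts_gphi_mult, (cts_comp k _ Hk), cts_affine. }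
  rewrite <- RInt_scal_cts by assumption.
  assert (H := RInt_comp_lin (fun y => gphi ((y - m) / s) * k y) s m ((a - m) / s) ((b - m) / s)).
  replace (s * ((a - m) / s) + m) with a in H by (field; lra).
  replace (s * ((b - m) / s) + m) with b in H by (field; lra).
  rewrite <- H by apply ex_RInt_cts, Hc.
  apply RInt_ext; intros r _; unfold scal; simpl; unfold mult; simpl.
  replace ((s * r + m - m) / s) with r by (field; lra).
  replace (s * r + m) with (m + s * r) by ring; reflexivity.
Qed.

(** Splits at [A]: inside, the weight is at most 1 on a length [2 A]; outside, only the global bound
    [B] is available and the tail is small. It handles functions that are small on compact sets but
    merely bounded elsewhere. *)
Lemma gint_tight (w : R -> R) B A delta :
  cts w -> (forall r, Rabs (w r) <= B) -> 0 < A -> (forall r, - A <= r <= A -> Rabs (w r) <= delta) ->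
  Rabs (gint w) <= 2 * A * delta + 4 * B / A.
Proof.
  intros Hw HB HA Hd.
  assert (H1 := gint_tail w B A (- A) A Hw HB HA ltac:(lra) ltac:(lra)).
  assert (H2 : Rabs (RInt (fun r => gphi r * w r) (- A) A) <= (A - - A) * delta).
  { apply abs_RInt_le_const; [lra | apply ex_RInt_cts, cts_gphi_mult, Hw |].
    intros t Ht; rewrite Rabs_mult, (Rabs_pos_eq (gphi t)) by (left; apply gphi_pos).
    generalize (Hd t Ht) (gphi_le_1 t) (gphi_pos t) (Rabs_pos (w t)); nra. }
  revert H1 H2; unfold Rabs; repeat destruct Rcase_abs; lra.
Qed.

(** * Rotation invariance of the planar Gaussian measure *)

Section Rotation.
Variables (a b : R).
Hypothesis (Hb : 0 < b) (Hab : a * a + b * b = 1).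

(* [x^2 + (u - a x)^2 / b^2 = u^2 + (x - a u)^2 / b^2] *)
Lemma gphi_rotation x u :
  gphi x * gphi ((u - a * x) / b) = gphi u * gphi ((x - a * u) / b).
Proof.
  unfold gphi; rewrite <- !exp_plus; f_equal.
  apply Rmult_eq_reg_l with (2 * (b * b)); [| nra].
  transitivity (- (b * b) * (x * x) - (u - a * x) * (u - a * x)); [field; lra |].
  transitivity (- (b * b) * (u * u) - (x - a * u) * (x - a * u)); [| field; lra].
  replace (b * b) with (1 - a * a) by lra; ring.
Qed.

Lemma cts_lin_div (p q : R) : cts (fun x => gphi ((p - q * x) / b)).
Proof.
  apply (cts_comp gphi (fun x => (p - q * x) / b) cts_gphi); intros x.
  apply (ex_derive_continuous (fun x => (p - q * x) / b)); auto_derive; auto.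
Qed.

(** By [gphi_rotation] the integrand is [gphi u] times a Gaussian in [x] centred at [a * u] with
    width [b], and rescaling that Gaussian produces the factor [b]. *)
Lemma gint_gphi_conv u :
  gint (fun x => gphi ((u - a * x) / b)) = b * gphi u * gint (fun _ => 1).
Proof.
  apply gint_charac; [apply cts_lin_div | apply (bnd_comp gphi), bnd_gphi |].
  intros eps He.
  destruct (small_tail (4 * 1 * b) eps He) as [N0 [HN0 HN0']].
  (* Chosen so that the rescaled endpoints [(- N - a * u) / b] and [(N - a * u) / b] lie beyond
     [- N0] and [N0]. *)
  exists (b * N0 + Rabs (a * u)); intros N HN.
  replace (RInt (fun r => gphi r * gphi ((u - a * r) / b)) (- N) N)
    with (gphi u * RInt (fun y => gphi ((y - a * u) / b) * 1) (- N) N).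
  2: { rewrite <- RInt_scal_cts.
       - apply RInt_ext; intros r _; simpl; rewrite gphi_rotation; ring.
       - apply cts_mult; [| apply cts_const].
         apply (cts_comp gphi (fun y => (y - a * u) / b) cts_gphi); intros x.
         apply (ex_derive_continuous (fun y => (y - a * u) / b)); auto_derive; auto. }
  rewrite (RInt_gphi_affine (fun _ => 1)) by (apply cts_const || assumption).
  assert (H : Rabs (RInt (fun r => gphi r * 1) ((- N - a * u) / b) ((N - a * u) / b)
              - gint (fun _ => 1)) <= 4 * 1 / N0).
  { apply gint_tail; [apply cts_const | intros; rewrite Rabs_R1; lra | assumption | |].
    - apply Rmult_le_reg_r with b; [assumption |].
      unfold Rdiv; rewrite Rmult_assoc, Rinv_l by lra.
      revert HN; unfold Rabs; destruct Rcase_abs; lra.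
    - apply Rmult_le_reg_r with b; [assumption |].
      unfold Rdiv; rewrite Rmult_assoc, Rinv_l by lra.
      revert HN; unfold Rabs; destruct Rcase_abs; lra. }
  set (I := RInt _ _ _) in *; set (c := gint (fun _ => 1)) in *.
  replace (gphi u * (b * I) - b * gphi u * c) with (gphi u * (b * (I - c))) by ring.
  rewrite !Rabs_mult, (Rabs_pos_eq (gphi u)), (Rabs_pos_eq b) by (generalize (gphi_pos u); lra).
  apply Rle_trans with (1 * (b * Rabs (I - c))).
  { apply Rmult_le_compat_r; [generalize (Rabs_pos (I - c)); nra | apply gphi_le_1]. }
  rewrite Rmult_1_l; apply Rle_trans with (b * (4 * 1 / N0)).
  { apply Rmult_le_compat_l; lra. }
  left; eapply Rle_lt_trans; [| exact HN0']; right; field; lra.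
Qed.

(** Substitute [u = a x + b y] in the inner integral, exchange, and integrate [x] out with
    [gint_gphi_conv]. The exchange is made for [u] in [[- N, N]], but in the variable [y] this
    window is shifted by [- a x / b], so the truncation is good only for bounded [x]; [gint_tight]
    absorbs the remaining [x]. *)
Lemma gint_rotation (k : R -> R) : cts k -> bnd k ->
  gint (fun x => gint (fun y => k (a * x + b * y))) = gint (fun _ => 1) * gint k.
Proof.
  intros Hk [B HB].
  set (c := gint (fun _ => 1)).
  assert (Hc : 0 < c) by apply gint_1_pos.
  assert (HB0 : 0 <= B) by (generalize (HB 0) (Rabs_pos (k 0)); lra).
  assert (Hc1 : cts (fun x => gint (fun y => k (a * x + b * y)))).
  { apply (cts_gint (fun p => k (a * fst p + b * snd p))).
    - apply (cts_comp (X := prod_UniformSpace R_UniformSpace R_UniformSpace) k (fun p => a * fst p + b * snd p) Hk).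
      apply cts_plus; apply cts_mult; (apply cts_const || apply cts_fst || apply cts_snd).
    - apply (bnd_comp k); exists B; assumption. }
  assert (Hka : forall x, cts (fun y => k (a * x + b * y))).
  { intros x; apply (cts_comp k _ Hk), cts_affine. }
  assert (HF : cts (X := prod_UniformSpace R_UniformSpace R_UniformSpace)
    (fun p => gphi ((fst p - a * snd p) / b) * k (fst p))).
  { apply cts_mult.
    - apply (cts_comp (X := prod_UniformSpace R_UniformSpace R_UniformSpace) gphi
        (fun p => (fst p - a * snd p) / b) cts_gphi).
      unfold Rdiv; apply cts_mult; [apply cts_minus | apply cts_const]; [apply cts_fst |].
      apply cts_mult; [apply cts_const | apply cts_snd].
    - apply (cts_comp (X := prod_UniformSpace R_UniformSpace R_UniformSpace) k fst Hk), cts_fst. }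
  assert (BF : bnd (fun p : R * R => gphi ((fst p - a * snd p) / b) * k (fst p))).
  { apply bnd_mult; [apply (bnd_comp gphi), bnd_gphi | apply (bnd_comp k); exists B; assumption]. }
  apply eq_of_small; intros eps He.
  (* Three errors of size [eps / 4]: [A] controls large [x], [N1] the inner tail for [x] in
     [[- A, A]], and [N2] the truncation of [gint k]. *)
  destruct (small_tail (4 * (2 * B * c)) (eps / 4) ltac:(lra)) as [A [HA HA']].
  destruct (small_tail (4 * B * (2 * A)) (eps / 4) ltac:(lra)) as [N1 [HN1 HN1']].
  destruct (small_tail (4 * B * c) (eps / 4) ltac:(lra)) as [N2 [HN2 HN2']].
  set (N := Rmax N2 (b * N1 + Rabs a * A)).
  assert (HNa : N2 <= N) by apply Rmax_l.
  assert (HNb : b * N1 + Rabs a * A <= N) by apply Rmax_r.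
  set (H := fun x => RInt (fun u => gphi ((u - a * x) / b) * k u) (- N) N).
  assert (HcH : cts H).
  { apply (cts_RInt_param (fun p => (fun q => gphi ((fst q - a * snd q) / b) * k (fst q)) (snd p, fst p))).
    apply (cts_swap (fun q => gphi ((fst q - a * snd q) / b) * k (fst q))), HF. }
  assert (HH : forall x, / b * H x = RInt (fun r => gphi r * k (a * x + b * r)) ((- N - a * x) / b) ((N - a * x) / b)).
  { intros x; unfold H; rewrite (RInt_gphi_affine k) by assumption; field; lra. }
  assert (HHb : forall x, Rabs (/ b * H x) <= B * c).
  { intros x; rewrite HH; eapply Rle_trans; [apply (RInt_gphi_abs (fun r => k (a * x + b * r)) B); auto |].
    - apply Rmult_le_compat_r; [left; apply Rinv_0_lt_compat; assumption | lra].
    - apply Rmult_le_compat_l; [assumption | apply RInt_gphi_le_gint].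
      apply Rmult_le_compat_r; [left; apply Rinv_0_lt_compat; assumption | lra]. }
  assert (HgH : gint (fun x => / b * H x) = c * RInt (fun u => gphi u * k u) (- N) N).
  { rewrite gint_scal; [| assumption | eexists; apply (bnd_RInt (fun p => gphi ((fst p - a * snd p) / b) * k (fst p)) _ _ _ HF (proj2_sig (constructive_indefinite_description _ BF)))].
    unfold H; rewrite (gint_RInt (fun p => gphi ((fst p - a * snd p) / b) * k (fst p))) by assumption.
    rewrite <- RInt_scal_cts.
    - rewrite <- RInt_scal_cts by (apply cts_gphi_mult; assumption).
      apply RInt_ext; intros u _; simpl.
      replace (fun r => gphi ((u - a * r) / b) * k u) with (fun r => k u * gphi ((u - a * r) / b))
        by (apply functional_extensionality; intros; ring).
      rewrite gint_scal by (apply cts_lin_div || apply (bnd_comp gphi), bnd_gphi).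
      rewrite gint_gphi_conv; unfold c; field; lra.
    - apply (cts_gint (fun p => gphi ((fst p - a * snd p) / b) * k (fst p))); assumption. }
  assert (E : gint (fun x => gint (fun y => k (a * x + b * y)) - / b * H x) =
     gint (fun x => gint (fun y => k (a * x + b * y))) - c * RInt (fun u => gphi u * k u) (- N) N).
  { rewrite <- HgH; apply gint_minus; [assumption | | | eexists; apply HHb].
    - apply cts_mult; [apply cts_const | assumption].
    - exists (B * c); intros x; apply gint_abs; auto. }
  assert (T1 : Rabs (gint (fun x => gint (fun y => k (a * x + b * y)) - / b * H x)) <=
     2 * A * (4 * B / N1) + 4 * (2 * B * c) / A).
  { apply gint_tight; [| | assumption |].
    - apply cts_minus; [assumption | apply cts_mult; [apply cts_const | assumption]].
    - intros x; generalize (HHb x) (gint_abs (fun y => k (a * x + b * y)) B (Hka x) (fun y => HB _)).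
      fold c; unfold Rabs; repeat destruct Rcase_abs; lra.
    - intros x Hx; rewrite HH, Rabs_minus_sym.
      assert (Hax : Rabs (a * x) <= Rabs a * A).
      { rewrite Rabs_mult; apply Rmult_le_compat_l; [apply Rabs_pos | apply Rabs_le; lra]. }
      apply (gint_tail (fun y => k (a * x + b * y))); auto.
      + apply Rmult_le_reg_r with b; [assumption |].
        unfold Rdiv; rewrite Rmult_assoc, Rinv_l by lra.
        revert Hax; unfold Rabs at 1; destruct Rcase_abs; lra.
      + apply Rmult_le_reg_r with b; [assumption |].
        unfold Rdiv; rewrite Rmult_assoc, Rinv_l by lra.
        revert Hax; unfold Rabs at 1; destruct Rcase_abs; lra. }
  rewrite E in T1.
  assert (T2 := gint_tail k B N2 (- N) N Hk HB HN2 ltac:(lra) ltac:(lra)).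
  set (I := RInt _ _ _) in *; set (g1 := gint (fun x => gint _)) in *; set (g2 := gint k) in *.
  replace (g1 - c * g2) with ((g1 - c * I) + c * (I - g2)) by ring.
  eapply Rle_trans; [apply Rabs_triang |].
  rewrite (Rabs_mult c), (Rabs_pos_eq c) by lra.
  apply Rle_trans with ((eps / 4 + eps / 4) + eps / 4); [| lra].
  apply Rplus_le_compat.
  - eapply Rle_trans; [exact T1 |]; apply Rplus_le_compat; [| lra].
    left; eapply Rle_lt_trans; [| exact HN1']; right; field; lra.
  - apply Rle_trans with (c * (4 * B / N2)); [apply Rmult_le_compat_l; lra |].
    left; eapply Rle_lt_trans; [| exact HN2']; right; field; lra.
Qed.

Lemma gauss_rotation (k : R -> R) : cts k -> bnd k ->
  gauss (fun x => gauss (fun y => k (a * x + b * y))) = gauss k.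
Proof.
  intros Hk Bk.
  assert (Hc : cts (fun x => gint (fun y => k (a * x + b * y))) /\ bnd (fun x => gint (fun y => k (a * x + b * y)))).
  { split; [apply (cts_gint (fun p => k (a * fst p + b * snd p))) | apply (bnd_gint (X := R_UniformSpace) (fun p => k (a * fst p + b * snd p)))];
    try apply (bnd_comp k), Bk;
    apply (cts_comp (X := prod_UniformSpace R_UniformSpace R_UniformSpace) k (fun p => a * fst p + b * snd p) Hk);
    apply cts_plus; apply cts_mult; (apply cts_const || apply cts_fst || apply cts_snd). }
  unfold gauss.
  replace (fun x => gint (fun y => k (a * x + b * y)) / gint (fun _ => 1))
    with (fun x => / gint (fun _ => 1) * gint (fun y => k (a * x + b * y)))
    by (apply functional_extensionality; intros; unfold Rdiv; ring).
  rewrite gint_scal, gint_rotation by tauto.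
  field; apply Rgt_not_eq, gint_1_pos.
Qed.

End Rotation.

(** Independent centred Gaussians add their variances. Scaling by [c] reduces to the unit rotation;
    [b = 0] is separate because the rotation divides by [b]. *)
Lemma gauss_gauss_sum (k : R -> R) x a b c : cts k -> bnd k ->
  0 <= a -> 0 <= b -> 0 <= c -> a * a + b * b = c * c ->
  gauss (fun p => gauss (fun q => k (x + a * p + b * q))) = gauss (fun r => k (x + c * r)).
Proof.
  intros Hk Bk Ha Hb Hc H.
  destruct (Req_dec b 0) as [-> | Hb0].
  - assert (a = c) by nra; subst c.
    f_equal; apply functional_extensionality; intros p.
    replace (fun q => k (x + a * p + 0 * q)) with (fun _ : R => k (x + a * p))
      by (apply functional_extensionality; intros; f_equal; ring).
    apply gauss_const.
  - assert (0 < c) by nra.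
    refine (eq_trans _ (gauss_rotation (a / c) (b / c) _ _ (fun r => k (x + c * r)) _ _)).
    + f_equal; apply functional_extensionality; intros p.
      f_equal; apply functional_extensionality; intros q; f_equal; field; lra.
    + apply Rdiv_lt_0_compat; lra.
    + replace (a / c * (a / c) + b / c * (b / c)) with ((a * a + b * b) / (c * c)) by (field; lra).
      rewrite H; field; lra.
    + apply (cts_comp k _ Hk), cts_affine.
    + apply (bnd_comp k), Bk.
Qed.

(** * The Gaussian functional on R^d *)

Definition unit_mixin : UniformSpace.mixin_of unit :=
  UniformSpace.Mixin unit tt (fun _ _ _ => True) (fun _ _ => I) (fun _ _ _ _ => I)
    (fun _ _ _ _ _ _ _ => I).

(** Follows the recursion of [Rn], so that [Rn (S n)] is convertible to a product of uniform spaces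
    and the continuity lemmas for pairs and projections apply to it directly. *)
Fixpoint Rn_mixin (d : nat) : UniformSpace.mixin_of (Rn d) :=
  match d with
  | O => unit_mixin
  | S n => prod_UniformSpace_mixin R_UniformSpace (UniformSpace.Pack (Rn n) (Rn_mixin n) (Rn n))
  end.

Canonical Rn_UniformSpace (d : nat) : UniformSpace :=
  UniformSpace.Pack (Rn d) (Rn_mixin d) (Rn d).

Definition BC {X : UniformSpace} (F : X -> R) : Prop := cts F /\ bnd F.

(** Iterated in the same coordinate order as [is_int_Rn], which lets the two be compared by
    induction on the dimension. *)
Fixpoint gaussn (d : nat) : (Rn d -> R) -> R :=
  match d return (Rn d -> R) -> R with
  | O => fun F => F tt
  | S n => fun F => gauss (fun r => gaussn n (fun y => F (r, y)))
  end.

Fixpoint axpy (d : nat) : Rn d -> R -> Rn d -> Rn d :=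
  match d return Rn d -> R -> Rn d -> Rn d with
  | O => fun _ _ _ => tt
  | S n => fun x a y => (fst x + a * fst y, axpy n (snd x) a (snd y))
  end.

Lemma cts_axpy {X : UniformSpace} (d : nat) (f g : X -> Rn d) (s : X -> R) :
  cts f -> cts s -> cts g -> cts (fun x => axpy d (f x) (s x) (g x)).
Proof.
  revert f g; induction d as [| d IH]; intros f g Hf Hs Hg.
  - apply (cts_const (Y := Rn_UniformSpace 0) tt).
  - apply (cts_pair (Y := R_UniformSpace) (Z := Rn_UniformSpace d)
      (fun x => fst (f x) + s x * fst (g x)) (fun x => axpy d (snd (f x)) (s x) (snd (g x)))).
    + apply cts_plus; [| apply cts_mult; [assumption |]];
        apply (cts_comp (Y := prod_UniformSpace R_UniformSpace (Rn_UniformSpace d)) fst); auto; apply cts_fst.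
    + apply IH; auto;
        apply (cts_comp (Y := prod_UniformSpace R_UniformSpace (Rn_UniformSpace d)) snd); auto; apply cts_snd.
Qed.

Lemma BC_comp {X Y : UniformSpace} (F : Y -> R) (g : X -> Y) : BC F -> cts g -> BC (fun x => F (g x)).
Proof. intros [HF BF] Hg; split; [apply (cts_comp F g); assumption | apply (bnd_comp F), BF]. Qed.

Lemma BC_const {X : UniformSpace} c : BC (fun _ : X => c).
Proof. split; [apply (cts_const (Y := R_UniformSpace)) | apply bnd_const]. Qed.

Lemma BC_plus {X : UniformSpace} (F G : X -> R) : BC F -> BC G -> BC (fun x => F x + G x).
Proof. intros [] []; split; [apply cts_plus | apply bnd_plus]; assumption. Qed.

Lemma BC_mult {X : UniformSpace} (F G : X -> R) : BC F -> BC G -> BC (fun x => F x * G x).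
Proof. intros [] []; split; [apply cts_mult | apply bnd_mult]; assumption. Qed.

Lemma BC_minus {X : UniformSpace} (F G : X -> R) : BC F -> BC G -> BC (fun x => F x - G x).
Proof.
  intros [HF [A HA]] [HG [B HB]]; split; [apply cts_minus; assumption |].
  exists (A + B); intros x; generalize (HA x) (HB x).
  unfold Rabs; repeat destruct Rcase_abs; lra.
Qed.

Ltac ctac := repeat match goal with
  | |- cts (fun x => x) => apply cts_id
  | |- cts (fun _ => ?c) => apply cts_const
  | |- cts (@fst _ _) => apply cts_fst
  | |- cts (@snd _ _) => apply cts_snd
  | |- cts (fun x => (@?f x, @?g x)) => apply (cts_pair f g)
  | |- cts (fun x => fst (@?f x)) => apply (cts_comp fst f cts_fst)
  | |- cts (fun x => snd (@?f x)) => apply (cts_comp snd f cts_snd)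
  | |- cts (fun x => @?f x + @?g x) => apply (cts_plus f g)
  | |- cts (fun x => @?f x - @?g x) => apply (cts_minus f g)
  | |- cts (fun x => @?f x * @?g x) => apply (cts_mult f g)
  | |- cts (fun x => sqrt (@?f x)) => apply (cts_comp sqrt f cts_sqrt)
  | |- cts (fun x => exp (@?f x)) => apply (cts_comp exp f cts_exp)
  | |- cts (fun x => axpy ?d (@?f x) (@?s x) (@?g x)) => apply (cts_axpy d f g s)
  | H : cts ?F |- cts ?F => exact H
  | H : cts ?F |- cts (fun x => ?F (@?g x)) => apply (cts_comp F g H)
  end.

Lemma BC_gauss {X : UniformSpace} (F : X * R -> R) :
  BC F -> BC (fun p => gauss (fun r => F (p, r))).
Proof. intros [H1 H2]; split; [apply cts_gauss | apply (bnd_gauss (X := X))]; assumption. Qed.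

Lemma BC_slice {X Y : UniformSpace} (F : X * Y -> R) x : BC F -> BC (fun y => F (x, y)).
Proof. intros H; apply (BC_comp F (fun y => (x, y)) H); ctac. Qed.

Lemma BC_slice_l {X Y : UniformSpace} (F : X * Y -> R) y : BC F -> BC (fun x => F (x, y)).
Proof. intros H; apply (BC_comp F (fun x => (x, y)) H); ctac. Qed.

Lemma BC_gaussn {X : UniformSpace} (d : nat) (F : X * Rn d -> R) :
  BC F -> BC (fun p => gaussn d (fun y => F (p, y))).
Proof.
  revert X F; induction d as [| d IH]; intros X F HF.
  - apply (BC_slice_l (Y := Rn_UniformSpace 0) F tt HF).
  - apply (BC_gauss (fun q => gaussn d (fun y => F (fst q, (snd q, y))))).
    apply (IH (prod_UniformSpace X R_UniformSpace) (fun z => F (fst (fst z), (snd (fst z), snd z)))).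
    apply (BC_comp (Y := prod_UniformSpace X (prod_UniformSpace R_UniformSpace (Rn_UniformSpace d))) F
      (fun z : (X * R) * Rn d => (fst (fst z), (snd (fst z), snd z))) HF); ctac.
Qed.

Lemma BC_gaussn_slice (d : nat) (F : Rn (S d) -> R) :
  BC F -> BC (fun r => gaussn d (fun y => F (r, y))).
Proof. intros HF; apply (BC_gaussn (X := R_UniformSpace) d F), HF. Qed.

Lemma BC_slice_Rn (d : nat) (F : Rn (S d) -> R) r : BC F -> BC (fun y : Rn d => F (r, y)).
Proof. intros HF; apply (BC_slice (X := R_UniformSpace) (Y := Rn_UniformSpace d) F r HF). Qed.

Lemma gaussn_abs (d : nat) (F : Rn d -> R) B :
  BC F -> (forall y, Rabs (F y) <= B) -> Rabs (gaussn d F) <= B.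
Proof.
  induction d as [| d IH]; intros HF HB; simpl; auto.
  apply gauss_abs; [apply BC_gaussn_slice, HF |].
  intros r; apply (IH (fun y => F (r, y))); auto using BC_slice_Rn.
Qed.

Lemma gaussn_const d c : gaussn d (fun _ => c) = c.
Proof. induction d as [| d IH]; simpl; auto; rewrite IH; apply gauss_const. Qed.

Lemma gaussn_plus d (F G : Rn d -> R) : BC F -> BC G ->
  gaussn d (fun y => F y + G y) = gaussn d F + gaussn d G.
Proof.
  induction d as [| d IH]; intros HF HG; simpl; auto.
  rewrite <- gauss_plus by (apply (BC_gaussn_slice d); assumption).
  f_equal; apply functional_extensionality; intros r.
  apply IH; apply BC_slice_Rn; assumption.
Qed.

Lemma gaussn_scal d c (F : Rn d -> R) : BC F ->
  gaussn d (fun y => c * F y) = c * gaussn d F.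
Proof.
  induction d as [| d IH]; intros HF; simpl; auto.
  rewrite <- gauss_scal by (apply (BC_gaussn_slice d); assumption).
  f_equal; apply functional_extensionality; intros r.
  apply IH, BC_slice_Rn, HF.
Qed.

Lemma gaussn_minus d (F G : Rn d -> R) : BC F -> BC G ->
  gaussn d (fun y => F y - G y) = gaussn d F - gaussn d G.
Proof.
  intros HF HG.
  replace (fun y => F y - G y) with (fun y => F y + (-1) * G y)
    by (apply functional_extensionality; intros; ring).
  rewrite gaussn_plus, gaussn_scal; auto; [ring |].
  apply BC_mult; [apply BC_const | assumption].
Qed.

Lemma gaussn_RInt d (F : R * Rn d -> R) a b : BC F ->
  gaussn d (fun y => RInt (fun s => F (s, y)) a b) = RInt (fun s => gaussn d (fun y => F (s, y))) a b.
Proof.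
  induction d as [| d IH]; intros HF; simpl; auto.
  transitivity (gauss (fun r => RInt (fun s => gaussn d (fun y => F (s, (r, y)))) a b)).
  - f_equal; apply functional_extensionality; intros r.
    apply (IH (fun q => F (fst q, (r, snd q)))).
    apply (BC_comp (Y := prod_UniformSpace R_UniformSpace (prod_UniformSpace R_UniformSpace (Rn_UniformSpace d)))
       F (fun q : R * Rn d => (fst q, (r, snd q))) HF); ctac.
  - assert (H : BC (fun q : R * R => gaussn d (fun y => F (fst q, (snd q, y))))).
    { apply (BC_gaussn (X := prod_UniformSpace R_UniformSpace R_UniformSpace) d
        (fun z => F (fst (fst z), (snd (fst z), snd z)))).
      apply (BC_comp (Y := prod_UniformSpace R_UniformSpace (prod_UniformSpace R_UniformSpace (Rn_UniformSpace d)))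
         F (fun z : (R * R) * Rn d => (fst (fst z), (snd (fst z), snd z))) HF); ctac. }
    apply (gauss_RInt (fun q => gaussn d (fun y => F (fst q, (snd q, y))))); apply H.
Qed.

Lemma gauss_gaussn d (F : R * Rn d -> R) : BC F ->
  gauss (fun q => gaussn d (fun y => F (q, y))) = gaussn d (fun y => gauss (fun q => F (q, y))).
Proof.
  induction d as [| d IH]; intros HF; simpl; auto.
  assert (H : BC (fun q : R * R => gaussn d (fun y => F (fst q, (snd q, y))))).
  { apply (BC_gaussn (X := prod_UniformSpace R_UniformSpace R_UniformSpace) d
      (fun z => F (fst (fst z), (snd (fst z), snd z)))).
    apply (BC_comp (Y := prod_UniformSpace R_UniformSpace (prod_UniformSpace R_UniformSpace (Rn_UniformSpace d)))
       F (fun z : (R * R) * Rn d => (fst (fst z), (snd (fst z), snd z))) HF); ctac. }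
  refine (eq_trans (gauss_gauss (fun q => gaussn d (fun y => F (fst q, (snd q, y)))) (proj1 H) (proj2 H)) _).
  f_equal; apply functional_extensionality; intros r; simpl.
  apply (IH (fun q => F (fst q, (r, snd q)))).
  apply (BC_comp (Y := prod_UniformSpace R_UniformSpace (prod_UniformSpace R_UniformSpace (Rn_UniformSpace d)))
     F (fun q : R * Rn d => (fst q, (r, snd q))) HF); ctac.
Qed.

(** Induction on the dimension. The scalar average over the first coordinate of [q] is first moved
    outside the [d]-dimensional average over [p], so that the two [d]-dimensional averages become
    adjacent for the induction hypothesis and the two scalar ones for [gauss_gauss_sum]. *)
Lemma gaussn_gaussn_sum d (g : Rn d -> R) x a b c : BC g ->
  0 <= a -> 0 <= b -> 0 <= c -> a * a + b * b = c * c ->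
  gaussn d (fun p => gaussn d (fun q => g (axpy d (axpy d x a p) b q))) =
  gaussn d (fun r => g (axpy d x c r)).
Proof.
  intros Hg Ha Hb Hc H; induction d as [| d IH]; [reflexivity |]; destruct x as [x1 x]; simpl.
  transitivity (gauss (fun p1 => gauss (fun q1 => gaussn d (fun p => gaussn d (fun q =>
     g (x1 + a * p1 + b * q1, axpy d (axpy d x a p) b q)))))).
  - f_equal; apply functional_extensionality; intros p1; symmetry.
    apply (gauss_gaussn d (fun z => gaussn d (fun q => g (x1 + a * p1 + b * fst z, axpy d (axpy d x a (snd z)) b q)))).
    apply (BC_gaussn (X := prod_UniformSpace R_UniformSpace (Rn_UniformSpace d)) d
      (fun z => g (x1 + a * p1 + b * fst (fst z), axpy d (axpy d x a (snd (fst z))) b (snd z)))).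
    apply (BC_comp (Y := prod_UniformSpace R_UniformSpace (Rn_UniformSpace d)) g
      (fun z : R * Rn d * Rn d => (x1 + a * p1 + b * fst (fst z), axpy d (axpy d x a (snd (fst z))) b (snd z))) Hg); ctac.
  - transitivity (gauss (fun p1 => gauss (fun q1 =>
       gaussn d (fun r => g (x1 + a * p1 + b * q1, axpy d x c r))))).
    + f_equal; apply functional_extensionality; intros p1.
      f_equal; apply functional_extensionality; intros q1.
      apply (IH (fun y => g (x1 + a * p1 + b * q1, y))), BC_slice_Rn, Hg.
    + assert (HB : BC (fun u => gaussn d (fun r => g (u, axpy d x c r)))).
      { apply (BC_gaussn (X := R_UniformSpace) d (fun z => g (fst z, axpy d x c (snd z)))).
        apply (BC_comp (Y := prod_UniformSpace R_UniformSpace (Rn_UniformSpace d)) g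
           (fun z : R * Rn d => (fst z, axpy d x c (snd z))) Hg); ctac. }
      apply (gauss_gauss_sum (fun u => gaussn d (fun r => g (u, axpy d x c r)))); auto; apply HB.
Qed.

(** * The heat potential *)

(* The heat semigroup at time [t - s] applied to [F (s, .)], evaluated at [x].
   As [sqrt] vanishes on negative reals, it is the identity for [t < s]. *)
Definition heat (d : nat) (F : R * Rn d -> R) (t s : R) (x : Rn d) : R :=
  gaussn d (fun y => F (s, axpy d x (sqrt (t - s)) y)).

Definition pot (d : nat) (F : R * Rn d -> R) (t : R) (x : Rn d) : R :=
  RInt (fun s => heat d F t s x) 0 t.

Lemma BC_slice_heat d (F : R * Rn d -> R) t s x :
  BC F -> BC (fun y => F (s, axpy d x (sqrt (t - s)) y)).
Proof.
  intros HF; apply (BC_comp F (fun y => (s, axpy d x (sqrt (t - s)) y)) HF); ctac.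
Qed.

Lemma BC_heat d (F : R * Rn d -> R) : BC F ->
  BC (fun q : R * R * Rn d => heat d F (fst (fst q)) (snd (fst q)) (snd q)).
Proof.
  intros HF.
  apply (BC_gaussn (X := prod_UniformSpace (prod_UniformSpace R_UniformSpace R_UniformSpace) (Rn_UniformSpace d)) d
    (fun z => F (snd (fst (fst z)), axpy d (snd (fst z)) (sqrt (fst (fst (fst z)) - snd (fst (fst z)))) (snd z)))).
  apply (BC_comp F (fun z : R * R * Rn d * Rn d => (snd (fst (fst z)), axpy d (snd (fst z)) (sqrt (fst (fst (fst z)) - snd (fst (fst z)))) (snd z))) HF).
  ctac.
Qed.

Lemma BC_heat_time d (F : R * Rn d -> R) t x : BC F -> BC (fun s => heat d F t s x).
Proof.
  intros HF; apply (BC_comp _ (fun s : R => ((t, s), x)) (BC_heat d F HF)); ctac.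
Qed.

(** With fixed integration bounds [t] is an ordinary parameter, and joint continuity of the
    potential follows from [cts_RInt_param]. *)
Lemma pot_unit_interval d (F : R * Rn d -> R) t x : BC F ->
  pot d F t x = t * RInt (fun r => heat d F t (t * r) x) 0 1.
Proof.
  intros HF; unfold pot.
  assert (H := RInt_comp_lin (fun s => heat d F t s x) t 0 0 1).
  replace (t * 0 + 0) with 0 in H by ring; replace (t * 1 + 0) with t in H by ring.
  rewrite <- H by apply ex_RInt_cts, BC_heat_time, HF.
  rewrite <- RInt_scal_cts.
  - apply RInt_ext; intros r _; unfold scal; simpl; unfold mult; simpl.
    rewrite Rplus_0_r; reflexivity.
  - assert (H' := proj1 (BC_heat_time d F t x HF)).
    apply (cts_comp (fun s => heat d F t s x) (fun r : R => t * r) H'); ctac.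
Qed.

Lemma cts_pot d (F : R * Rn d -> R) : BC F -> cts (fun p : R * Rn d => pot d F (fst p) (snd p)).
Proof.
  intros HF.
  replace (fun p : R * Rn d => pot d F (fst p) (snd p))
    with (fun p : R * Rn d => fst p * RInt (fun r => heat d F (fst p) (fst p * r) (snd p)) 0 1)
    by (apply functional_extensionality; intros p; symmetry; apply pot_unit_interval, HF).
  apply (cts_mult (X := prod_UniformSpace R_UniformSpace (Rn_UniformSpace d)) fst
    (fun p => RInt (fun r => heat d F (fst p) (fst p * r) (snd p)) 0 1)); [ctac |].
  apply (cts_RInt_param (X := prod_UniformSpace R_UniformSpace (Rn_UniformSpace d))
    (fun q => heat d F (fst (fst q)) (fst (fst q) * snd q) (snd (fst q)))).
  assert (H := proj1 (BC_heat d F HF)).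
  apply (cts_comp (fun q : R * R * Rn d => heat d F (fst (fst q)) (snd (fst q)) (snd q))
    (fun q : R * Rn d * R => ((fst (fst q), fst (fst q) * snd q), snd (fst q))) H).
  ctac.
Qed.

Lemma heat_abs d (F : R * Rn d -> R) t s x B :
  BC F -> (forall y, Rabs (F (s, y)) <= B) -> Rabs (heat d F t s x) <= B.
Proof. intros HF HB; apply gaussn_abs; auto; apply BC_slice_heat, HF. Qed.

Lemma heat_plus_scal d (F G : R * Rn d -> R) c t s x : BC F -> BC G ->
  heat d (fun p => F p + c * G p) t s x = heat d F t s x + c * heat d G t s x.
Proof.
  intros HF HG; unfold heat.
  rewrite gaussn_plus; [rewrite gaussn_scal; [reflexivity |] | |].
  - apply BC_slice_heat, HG.
  - apply BC_slice_heat, HF.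
  - apply BC_mult; [apply BC_const | apply (BC_slice_heat d G), HG].
Qed.

Lemma pot_minus d (F G : R * Rn d -> R) t x : BC F -> BC G ->
  pot d (fun p => F p - G p) t x = pot d F t x - pot d G t x.
Proof.
  intros HF HG; unfold pot.
  rewrite <- RInt_minus_cts by (apply BC_heat_time; assumption).
  apply RInt_ext; intros s _; unfold heat; apply gaussn_minus; apply BC_slice_heat; assumption.
Qed.

Lemma Rabs_RInt_le_fun (f g : R -> R) a b :
  a <= b -> cts f -> cts g -> (forall t, a <= t <= b -> Rabs (f t) <= g t) ->
  Rabs (RInt f a b) <= RInt g a b.
Proof.
  intros Hab Hf Hg H.
  eapply Rle_trans; [apply abs_RInt_le; auto using ex_RInt_cts |].
  apply RInt_le_cts; auto.
  apply (cts_comp Rabs f); [intros x; apply continuous_Rabs | exact Hf].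
Qed.

Lemma pot_abs d (F : R * Rn d -> R) (A : R -> R) t x :
  BC F -> cts A -> 0 <= t -> (forall s y, 0 <= s <= t -> Rabs (F (s, y)) <= A s) ->
  Rabs (pot d F t x) <= RInt A 0 t.
Proof.
  intros HF HA Ht HB; apply Rabs_RInt_le_fun; auto.
  - apply BC_heat_time, HF.
  - intros s Hs; apply heat_abs; auto.
Qed.

(** Exchange the spatial average with the integral over [r], then apply the semigroup law; the
    variances match because [(t - s) + (s - r) = t - r]. *)
Lemma heat_pot d (F V : R * Rn d -> R) t s x : BC F -> 0 <= s <= t ->
  (forall y, V (s, y) = pot d F s y) ->
  heat d V t s x = RInt (fun r => heat d F t r x) 0 s.
Proof.
  intros HF Hs HV; unfold heat at 1.
  replace (fun y => V (s, axpy d x (sqrt (t - s)) y))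
    with (fun y => RInt (fun r => heat d F s r (axpy d x (sqrt (t - s)) y)) 0 s)
    by (apply functional_extensionality; intros y; rewrite HV; reflexivity).
  rewrite (gaussn_RInt d (fun q => heat d F s (fst q) (axpy d x (sqrt (t - s)) (snd q)))).
  - apply RInt_ext; intros r Hr; unfold heat; simpl.
    rewrite Rmin_left, Rmax_right in Hr by lra.
    apply (gaussn_gaussn_sum d (fun y => F (r, y))); try apply sqrt_pos.
    + apply (BC_slice (X := R_UniformSpace) (Y := Rn_UniformSpace d) F r HF).
    + rewrite !sqrt_sqrt by lra; ring.
  - apply (BC_comp (fun q : R * R * Rn d => heat d F (fst (fst q)) (snd (fst q)) (snd q))
      (fun q : R * Rn d => ((s, fst q), axpy d x (sqrt (t - s)) (snd q))) (BC_heat d F HF)).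
    ctac.
Qed.

(* Duhamel's formula for the semigroup damped by [exp (- L t)]: by [heat_pot] the
   integrand is the derivative of [exp (- L (t - s)) * int_0^s heat F t r x dr]. *)
Lemma pot_damped d (F V : R * Rn d -> R) T L t x :
  BC F -> BC V -> (forall t x, 0 <= t <= T -> V (t, x) = pot d F t x) -> 0 <= t <= T ->
  V (t, x) = RInt (fun s => exp (- L * (t - s)) * heat d (fun p => F p + L * V p) t s x) 0 t.
Proof.
  intros HF HV HVF Ht; symmetry.
  set (q := fun s => heat d F t s x).
  assert (Hq : cts q) by (apply BC_heat_time, HF).
  set (H := fun s => RInt q 0 s).
  assert (HH : forall s, is_derive H s (q s)) by (intros s; apply is_derive_RInt_cts, Hq).
  assert (Hex : cts (fun s => exp (- L * (t - s)))) by ctac.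
  assert (HcH : cts H) by (intros s; apply (ex_derive_continuous H); eexists; apply HH).
  transitivity (RInt (fun s => exp (- L * (t - s)) * (q s + L * H s)) 0 t).
  - apply RInt_ext; intros s Hs; rewrite Rmin_left, Rmax_right in Hs by lra.
    rewrite heat_plus_scal by assumption; unfold H, q.
    rewrite <- (heat_pot d F V t s x); auto; [lra |].
    intros y; apply HVF; lra.
  - apply is_RInt_unique.
    replace (V (t, x)) with (minus (exp (- L * (t - t)) * H t) (exp (- L * (t - 0)) * H 0)).
    + apply (is_RInt_derive (fun s => exp (- L * (t - s)) * H s)).
      * intros s _.
        evar_last.
        { apply (is_derive_mult (fun s => exp (- L * (t - s))) H s (L * exp (- L * (t - s))) (q s)).
          - auto_derive; [auto | unfold Rminus; ring].
          - apply HH.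
          - intros; apply Rmult_comm. }
        unfold plus, mult; simpl; ring.
      * intros s _; apply (cts_mult _ _ Hex (cts_plus _ _ Hq (cts_mult _ _ (cts_const L) HcH))).
    + rewrite HVF by assumption.
      replace (H 0) with 0 by (unfold H; rewrite RInt_point; reflexivity).
      replace (- L * (t - t)) with 0 by ring; rewrite exp_0.
      unfold minus, plus, opp, H, pot; simpl; fold q; ring.
Qed.

Lemma exp_mono x y : x <= y -> exp x <= exp y.
Proof. intros [H | ->]; [left; apply exp_increasing, H | right; reflexivity]. Qed.

Lemma RInt_exp_le c t : 0 < c -> RInt (fun s => exp (c * s)) 0 t <= exp (c * t) / c.
Proof.
  intros Hc.
  replace (RInt (fun s => exp (c * s)) 0 t) with (exp (c * t) / c - 1 / c).
  - assert (0 < 1 / c) by (apply Rdiv_lt_0_compat; lra); lra.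
  - symmetry; apply is_RInt_unique.
    replace (exp (c * t) / c - 1 / c) with (minus (exp (c * t) / c) (exp (c * 0) / c)).
    + apply (is_RInt_derive (fun s => exp (c * s) / c)).
      * intros s _; auto_derive; [auto | field; lra].
      * intros s _; assert (H : cts (fun s => exp (c * s))) by ctac; apply H.
    + rewrite Rmult_0_r, exp_0; reflexivity.
Qed.

(* [A := sup |V| exp (- (kappa + 1) t)] satisfies [A <= ((kappa + L) A + eps) / (kappa + 1 + L)],
   hence [A <= eps], whatever the size of [L]. *)
Lemma comparison d (F V : R * Rn d -> R) T L kappa eps :
  BC F -> BC V -> 0 <= T -> 0 <= L -> 0 <= kappa -> 0 <= eps ->
  (forall t x, 0 <= t <= T -> V (t, x) = pot d F t x) ->
  (forall t x, 0 <= t <= T ->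
     Rabs (F (t, x) + L * V (t, x)) <= (kappa + L) * Rabs (V (t, x)) + eps) ->
  forall t x, 0 <= t <= T -> Rabs (V (t, x)) <= eps * exp ((kappa + 1) * t).
Proof.
  intros HF HV HT HL Hk He HVF HFV.
  set (lam := kappa + 1).
  set (E := fun r => exists t x, 0 <= t <= T /\ r = Rabs (V (t, x)) * exp (- lam * t)).
  assert (Hexp : forall t, exp (lam * t) * exp (- lam * t) = 1).
  { intros t; rewrite <- exp_plus, <- exp_0; f_equal; ring. }
  assert (HA : exists A, is_lub E A).
  { destruct (completeness E) as [A HA]; [| | exists A; exact HA].
    - destruct HV as [_ [B HB]]; exists B; intros r [t [x [Ht ->]]].
      assert (exp (- lam * t) <= 1).
      { rewrite <- exp_0; apply exp_mono; unfold lam; nra. }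
      generalize (HB (t, x)) (Rabs_pos (V (t, x))) (exp_pos (- lam * t)); nra.
    - exists (Rabs (V (0, UniformSpace.point_of _ (Rn_mixin d))) * exp (- lam * 0)).
      exists 0; eexists; split; [lra | reflexivity]. }
  destruct HA as [A [HA1 HA2]].
  assert (HVA : forall t x, 0 <= t <= T -> Rabs (V (t, x)) <= A * exp (lam * t)).
  { intros t x Ht.
    assert (H : Rabs (V (t, x)) * exp (- lam * t) <= A) by (apply HA1; exists t, x; split; auto).
    apply Rmult_le_compat_r with (r := exp (lam * t)) in H; [| left; apply exp_pos].
    rewrite Rmult_assoc, (Rmult_comm (exp (- lam * t))), Hexp, Rmult_1_r in H; exact H. }
  assert (HA0 : 0 <= A).
  { generalize (HVA 0 (UniformSpace.point_of _ (Rn_mixin d)) ltac:(lra)) (exp_pos (lam * 0)).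
    generalize (Rabs_pos (V (0, UniformSpace.point_of _ (Rn_mixin d)))); nra. }
  assert (HC0 : 0 <= (kappa + L) * A + eps) by nra.
  set (C := (kappa + L) * A + eps) in *.
  assert (Hnew : forall t x, 0 <= t <= T -> Rabs (V (t, x)) <= C / (lam + L) * exp (lam * t)).
  { intros t x Ht.
    rewrite (pot_damped d F V T L t x) by assumption.
    assert (HBC : BC (fun p => F p + L * V p)).
    { apply BC_plus; [assumption | apply BC_mult; [apply BC_const | assumption]]. }
    eapply Rle_trans.
    { apply (Rabs_RInt_le_fun _ (fun s => C * exp (- L * t) * exp ((lam + L) * s))); [lra | | ctac |].
      - assert (Hh := proj1 (BC_heat_time d _ t x HBC)).
        apply (cts_mult (fun s => exp (- L * (t - s))) (fun s => heat d (fun p => F p + L * V p) t s x)); ctac.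
      - intros s Hs; rewrite Rabs_mult, (Rabs_pos_eq (exp _)) by (left; apply exp_pos).
        replace (C * exp (- L * t) * exp ((lam + L) * s)) with (exp (- L * (t - s)) * (C * exp (lam * s))).
        + apply Rmult_le_compat_l; [left; apply exp_pos |].
          apply heat_abs; [assumption |]; intros y.
          eapply Rle_trans; [apply HFV; lra |].
          (* This lets [eps] be absorbed into [eps * exp (lam * s)], so that both terms carry the
             same weight. *)
          assert (1 <= exp (lam * s)).
          { rewrite <- exp_0; apply exp_mono; unfold lam; nra. }
          generalize (HVA s y ltac:(lra)); unfold C; intros.
          apply Rle_trans with ((kappa + L) * (A * exp (lam * s)) + eps); [| nra].
          apply Rplus_le_compat_r, Rmult_le_compat_l; lra.
        + replace (- L * (t - s)) with (- L * t + L * s) by ring.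
          replace ((lam + L) * s) with (lam * s + L * s) by ring.
          rewrite !exp_plus; ring. }
    rewrite RInt_scal_cts by ctac.
    assert (Hl : 0 < lam + L) by (unfold lam; lra).
    apply Rle_trans with (C * exp (- L * t) * (exp ((lam + L) * t) / (lam + L))).
    - apply Rmult_le_compat_l; [generalize (exp_pos (- L * t)); nra | apply RInt_exp_le, Hl].
    - right; replace ((lam + L) * t) with (lam * t - - L * t) by ring.
      unfold Rminus; rewrite exp_plus, exp_Ropp; field; split; [lra | apply Rgt_not_eq, exp_pos]. }
  assert (HAe : A <= eps).
  { assert (H : A <= C / (lam + L)).
    { apply HA2; intros r [t [x [Ht ->]]].
      generalize (Hnew t x Ht); intros H.
      apply Rmult_le_compat_r with (r := exp (- lam * t)) in H; [| left; apply exp_pos].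
      rewrite Rmult_assoc, Hexp, Rmult_1_r in H; exact H. }
    assert (Hl : 0 < lam + L) by (unfold lam; lra).
    apply Rmult_le_compat_r with (r := lam + L) in H; [| lra].
    unfold Rdiv in H; rewrite Rmult_assoc, Rinv_l, Rmult_1_r in H by lra.
    unfold C, lam in H; lra. }
  intros t x Ht; eapply Rle_trans; [apply HVA, Ht |].
  apply Rmult_le_compat_r; [left; apply exp_pos | assumption].
Qed.

(** * Lipschitz and dissipative nonlinearities *)

Definition clamp (a b x : R) : R := Rmax a (Rmin b x).

Lemma clamp_in a b x : a <= b -> a <= clamp a b x <= b.
Proof. intros; unfold clamp, Rmax, Rmin; repeat destruct Rle_dec; lra. Qed.

Lemma clamp_id a b x : a <= x <= b -> clamp a b x = x.
Proof. intros; unfold clamp, Rmax, Rmin; repeat destruct Rle_dec; lra. Qed.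

Lemma clamp_lip a b x y : a <= b -> Rabs (clamp a b x - clamp a b y) <= Rabs (x - y).
Proof.
  intros; unfold clamp, Rmax, Rmin; repeat destruct Rle_dec;
    unfold Rabs; repeat destruct Rcase_abs; lra.
Qed.

Lemma clamp_incr a b x y : a <= b -> x <= y ->
  clamp a b x <= clamp a b y /\ clamp a b y - clamp a b x <= y - x.
Proof. intros; unfold clamp, Rmax, Rmin; repeat destruct Rle_dec; lra. Qed.

Lemma cts_clamp a b : a <= b -> cts (clamp a b).
Proof.
  intros Hab; apply cts_eps; intros x eps He.
  exists (mkposreal eps He); intros y Hy.
  eapply Rle_lt_trans; [apply clamp_lip, Hab | exact Hy].
Qed.

Lemma BC_complete {X : UniformSpace} (V : nat -> X -> R) :
  (forall n, BC (V n)) ->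
  (forall eps, 0 < eps -> exists N, forall n m x, (N <= n)%nat -> (N <= m)%nat ->
     Rabs (V n x - V m x) <= eps) ->
  exists W, BC W /\ forall eps, 0 < eps -> exists N, forall n x, (N <= n)%nat ->
     Rabs (V n x - W x) <= eps.
Proof.
  intros HV HC.
  assert (Hl : forall x, is_lim_seq (fun n => V n x) (real (Lim_seq (fun n => V n x)))).
  { intros x; apply Lim_seq_correct', ex_lim_seq_cauchy_corr.
    intros eps; destruct (HC (eps / 2)) as [N HN]; [destruct eps; simpl; lra |].
    exists N; intros n m Hn Hm; generalize (HN n m x Hn Hm); destruct eps; simpl; lra. }
  set (W := fun x => real (Lim_seq (fun n => V n x))).
  assert (HW : forall eps, 0 < eps -> exists N, forall n x, (N <= n)%nat -> Rabs (V n x - W x) <= eps).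
  { intros eps He; destruct (HC eps He) as [N HN]; exists N; intros n x Hn.
    assert (H : is_lim_seq (fun m => Rabs (V n x - V m x)) (Rabs (V n x - W x))).
    { apply (is_lim_seq_abs _ (Finite _)), is_lim_seq_minus'; [apply is_lim_seq_const | apply Hl]. }
    refine (is_lim_seq_le_loc _ (fun _ => eps) (Finite _) (Finite _) _ H (is_lim_seq_const _)).
    exists N; intros m Hm; apply HN; assumption. }
  exists W; split; [split | exact HW].
  - apply cts_unif_lim; intros eps He; destruct (HW eps He) as [N HN].
    exists (V N); split; [apply HV |]; intros x; rewrite Rabs_minus_sym; apply HN; lia.
  - destruct (HW 1 Rlt_0_1) as [N HN]; destruct (HV N) as [_ [B HB]].
    exists (B + 1); intros x; generalize (HB x) (HN N x (Nat.le_refl _)).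
    unfold Rabs; repeat destruct Rcase_abs; lra.
Qed.

(** Freezing time outside [[0, T]] keeps the potential bounded on all of [R * Rn d], whereas [pot]
    may grow linearly in [t]. Fixed-point equations can then be stated at every point. *)
Definition potc (d : nat) (T : R) (F : R * Rn d -> R) (p : R * Rn d) : R :=
  pot d F (clamp 0 T (fst p)) (snd p).

Lemma potc_diff d T (F G : R * Rn d -> R) e : 0 <= T -> BC F -> BC G -> 
  (forall p, Rabs (F p - G p) <= e) -> forall p, Rabs (potc d T F p - potc d T G p) <= T * e.
Proof.
  intros HT HF HG H p; unfold potc.
  assert (Hc := clamp_in 0 T (fst p) HT); set (t := clamp 0 T (fst p)) in *.
  assert (He : 0 <= e) by (generalize (H p) (Rabs_pos (F p - G p)); lra).
  rewrite <- pot_minus by assumption.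
  eapply Rle_trans; [apply (pot_abs d _ (fun _ => e)); [| apply cts_const | lra | intros; apply H] |].
  - split; [apply (cts_minus F G (proj1 HF) (proj1 HG)) | exists e; exact H].
  - rewrite RInt_const; unfold scal; simpl; unfold mult; simpl; nra.
Qed.

Lemma potc_0 d T p : potc d T (fun _ => 0) p = 0.
Proof.
  unfold potc, pot, heat; rewrite gaussn_const, RInt_const.
  unfold scal; simpl; unfold mult; simpl; ring.
Qed.

Lemma BC_potc d T (F : R * Rn d -> R) : 0 <= T -> BC F -> BC (potc d T F).
Proof.
  intros HT HF; split.
  - assert (H1 := cts_pot d F HF); assert (H2 := cts_clamp 0 T HT).
    apply (cts_comp (fun p : R * Rn d => pot d F (fst p) (snd p))
      (fun p : R * Rn d => (clamp 0 T (fst p), snd p)) H1); ctac.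
  - destruct (proj2 HF) as [B HB]; exists (T * B); intros p.
    assert (H := potc_diff d T F (fun _ => 0) B HT HF (BC_const 0)
      ltac:(intros; rewrite Rminus_0_r; apply HB) p).
    rewrite potc_0, Rminus_0_r in H; exact H.
Qed.

Lemma BC_nonlin {X : UniformSpace} (g : R -> R) (V Z : X -> R) :
  BC g -> BC V -> BC Z -> BC (fun p => g (V p + Z p)).
Proof. intros Hg HV HZ; apply (BC_comp g (fun p => V p + Z p) Hg), cts_plus; [apply HV | apply HZ]. Qed.

Lemma cts_lip (g : R -> R) Lam : 0 < Lam ->
  (forall u v, Rabs (g u - g v) <= Lam * Rabs (u - v)) -> cts g.
Proof.
  intros HL Hg; apply cts_eps; intros x eps He.
  assert (Hd : 0 < eps / Lam) by (apply Rdiv_lt_0_compat; lra).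
  exists (mkposreal _ Hd); intros y Hy.
  eapply Rle_lt_trans; [apply Hg |].
  apply Rmult_lt_reg_l with (/ Lam); [apply Rinv_0_lt_compat, HL |].
  rewrite <- Rmult_assoc, Rinv_l, Rmult_1_l, Rmult_comm by lra; exact Hy.
Qed.

Lemma half_pow_small C eps : 0 < eps -> exists N, forall n, (N <= n)%nat -> C * (1 / 2) ^ n <= eps.
Proof.
  intros He.
  assert (H : is_lim_seq (fun n => C * (1 / 2) ^ n) 0).
  { replace (Finite 0) with (Rbar_mult C 0) by (simpl; f_equal; ring).
    apply is_lim_seq_scal_l, is_lim_seq_geom; rewrite Rabs_pos_eq; lra. }
  apply is_lim_seq_spec in H; destruct (H (mkposreal eps He)) as [N HN].
  exists N; intros n Hn; generalize (HN n Hn); simpl; rewrite Rminus_0_r.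
  unfold Rabs; destruct Rcase_abs; lra.
Qed.

(* Picard iteration, contracting by the factor [1 / 2] in the norm weighted by [exp (- 2 Lam t)]. *)
Lemma lipschitz_solution d T (g : R -> R) Lam (Z : R * Rn d -> R) :
  0 <= T -> 0 < Lam -> bnd g -> (forall u v, Rabs (g u - g v) <= Lam * Rabs (u - v)) -> BC Z ->
  exists V, BC V /\ forall p, V p = potc d T (fun p => g (V p + Z p)) p.
Proof.
  intros HT HL Bg Lg HZ.
  assert (Hg : BC g) by (split; [apply (cts_lip g Lam); assumption | exact Bg]).
  set (Phi := fun V => potc d T (fun p => g (V p + Z p))).
  set (V := fun n => Nat.iter n Phi (fun _ => 0)).
  assert (HV : forall n, BC (V n)).
  { induction n as [| n IH]; [apply BC_const | apply BC_potc; auto using BC_nonlin]. }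
  assert (Hc : forall n t x, V n (t, x) = V n (clamp 0 T t, x)).
  { intros [| n] t x; [reflexivity |].
    simpl; unfold Phi, potc; simpl; rewrite (clamp_id 0 T (clamp 0 T t)); auto using clamp_in. }
  destruct (proj2 (HV 1%nat)) as [B HB].
  assert (HB0 : 0 <= B) by (generalize (HB (0, UniformSpace.point_of _ (Rn_mixin d))) (Rabs_pos (V 1%nat (0, UniformSpace.point_of _ (Rn_mixin d)))); lra).
  (* The factor [1 / 2] arises because integrating [Lam * exp (2 * Lam * s)] over [[0, t]] gives at
     most [exp (2 * Lam * t) / 2]. *)
  assert (Hst : forall n t x, 0 <= t <= T ->
    Rabs (V (S n) (t, x) - V n (t, x)) <= B * (1 / 2) ^ n * exp (2 * Lam * t)).
  { induction n as [| n IH]; intros t x Ht.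
    - assert (1 <= exp (2 * Lam * t)) by (rewrite <- exp_0; apply exp_mono; nra).
      simpl pow; change (V 0%nat (t, x)) with 0; rewrite Rminus_0_r; generalize (HB (t, x)); nra.
    - change (V (S (S n))) with (Phi (V (S n))); change (V (S n) (t, x)) with (Phi (V n) (t, x)).
      unfold Phi, potc; simpl fst; simpl snd; rewrite clamp_id by assumption.
      rewrite <- pot_minus by (apply BC_nonlin; auto).
      assert (Hpos : 0 <= B * (1 / 2) ^ n) by (apply Rmult_le_pos; [assumption | apply pow_le; lra]).
      eapply Rle_trans.
      { apply (pot_abs d _ (fun s => Lam * (B * (1 / 2) ^ n) * exp (2 * Lam * s))); [| ctac | lra |].
        - assert (H1 := BC_nonlin g (V (S n)) Z Hg (HV _) HZ).
          assert (H2 := BC_nonlin g (V n) Z Hg (HV _) HZ).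
          exact (BC_minus _ _ H1 H2).
        - intros s y Hs; eapply Rle_trans; [apply Lg |].
          rewrite Rmult_assoc; apply Rmult_le_compat_l; [lra |].
          replace (V (S n) (s, y) + Z (s, y) - (V n (s, y) + Z (s, y)))
            with (V (S n) (s, y) - V n (s, y)) by ring.
          apply IH; lra. }
      rewrite RInt_scal_cts by ctac.
      apply Rle_trans with (Lam * (B * (1 / 2) ^ n) * (exp (2 * Lam * t) / (2 * Lam))).
      + apply Rmult_le_compat_l; [apply Rmult_le_pos; lra |].
        apply (RInt_exp_le (2 * Lam)); lra.
      + right; simpl pow; field; lra. }
  set (C := B * exp (2 * Lam * T)).
  assert (HC0 : 0 <= C) by (unfold C; generalize (exp_pos (2 * Lam * T)); nra).
  assert (Hst' : forall n p, Rabs (V (S n) p - V n p) <= C * (1 / 2) ^ n).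
  { intros n [t x]; rewrite (Hc (S n)), (Hc n).
    assert (Ht := clamp_in 0 T t HT).
    eapply Rle_trans; [apply Hst, Ht |].
    assert (exp (2 * Lam * clamp 0 T t) <= exp (2 * Lam * T)) by (apply exp_mono; nra).
    assert (0 <= B * (1 / 2) ^ n) by (apply Rmult_le_pos; [assumption | apply pow_le; lra]).
    unfold C; nra. }
  (* Telescoping, with the geometric sum in closed form: [2 - 2 * (1 / 2) ^ j] is the sum of
     [(1 / 2) ^ i] over [i < j]. *)
  assert (Hsum : forall j n p, Rabs (V (n + j)%nat p - V n p) <= C * (1 / 2) ^ n * (2 - 2 * (1 / 2) ^ j)).
  { induction j as [| j IH]; intros n p.
    - rewrite Nat.add_0_r, Rminus_diag, Rabs_R0; simpl; lra.
    - rewrite Nat.add_succ_r.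
      generalize (IH n p) (Hst' (n + j)%nat p); rewrite pow_add; simpl pow; intros H1 H2.
      assert (H3 := Rabs_triang (V (S (n + j)) p - V (n + j)%nat p) (V (n + j)%nat p - V n p)).
      replace (V (S (n + j)) p - V (n + j)%nat p + (V (n + j)%nat p - V n p))
        with (V (S (n + j)) p - V n p) in H3 by ring.
      eapply Rle_trans; [exact H3 |].
      eapply Rle_trans; [apply Rplus_le_compat; [exact H2 | exact H1] | right; field]. }
  destruct (BC_complete V HV) as [W [HW HVW]].
  { intros eps He; destruct (half_pow_small (4 * C) eps He) as [N HN].
    exists N; intros n m p Hn Hm.
    assert (Hb : forall n, (N <= n)%nat -> Rabs (V n p - V N p) <= 2 * C * (1 / 2) ^ N).
    { clear n m Hn Hm; intros n Hn; replace n with (N + (n - N))%nat by lia.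
      eapply Rle_trans; [apply Hsum |].
      assert (0 <= C * (1 / 2) ^ N) by (apply Rmult_le_pos; [assumption | apply pow_le; lra]).
      assert (0 < (1 / 2) ^ (n - N)) by (apply pow_lt; lra).
      nra. }
    generalize (Hb n Hn) (Hb m Hm) (HN N (Nat.le_refl _)).
    unfold Rabs; repeat destruct Rcase_abs; lra. }
  exists W; split; [exact HW |]; intros p; apply eq_of_small; intros eps He.
  (* The error has two sources: the distance from [V (S N)] to [W], and the distance of the
     potentials, which costs a further factor [T * Lam]. *)
  set (K := 1 + T * Lam).
  assert (HK : 0 < K) by (unfold K; nra).
  assert (He' : 0 < eps / K) by (apply Rdiv_lt_0_compat; lra).
  destruct (HVW _ He') as [N HN].
  assert (H1 := HN (S N) p ltac:(lia)).
  assert (H2 : Rabs (V (S N) p - potc d T (fun p => g (W p + Z p)) p) <= T * (Lam * (eps / K))).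
  { apply (potc_diff d T (fun p => g (V N p + Z p)) (fun p => g (W p + Z p))); auto using BC_nonlin.
    intros q; eapply Rle_trans; [apply Lg |].
    apply Rmult_le_compat_l; [lra |].
    replace (V N q + Z q - (W q + Z q)) with (V N q - W q) by ring; apply HN; lia. }
  replace eps with (eps / K + T * (Lam * (eps / K))) by (unfold K; field; unfold K in HK; lra).
  revert H1 H2; unfold Rabs; repeat destruct Rcase_abs; lra.
Qed.

(** * One-sided bounds, stability and Lipschitz approximation *)

Definition one_sided (kappa : R) (f : R -> R) : Prop :=
  forall u1 u2, u1 < u2 -> f u2 - f u1 <= kappa * (u2 - u1).

(** The difference quotients of [f] lie in [[- L, kappa]], so adding [L] moves them to
    [[0, kappa + L]]: the steep decrease of [f] disappears from the bound. *)
Lemma one_sided_shift kappa f L u v :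
  0 <= kappa -> 0 <= L -> one_sided kappa f ->
  (forall u v, Rabs (f u - f v) <= L * Rabs (u - v)) ->
  Rabs (f u - f v + L * (u - v)) <= (kappa + L) * Rabs (u - v).
Proof.
  intros Hk HL Ho Hl; destruct (Rtotal_order u v) as [H | [-> | H]].
  - assert (H1 := Ho u v H); assert (H2 := Hl u v).
    rewrite (Rabs_left (u - v)) in * by lra.
    apply Rabs_le; revert H2; unfold Rabs; destruct Rcase_abs; nra.
  - rewrite !Rminus_diag, Rabs_R0, Rmult_0_r, Rplus_0_r, Rabs_R0; lra.
  - assert (H1 := Ho v u H); assert (H2 := Hl u v).
    rewrite (Rabs_right (u - v)) in * by lra.
    apply Rabs_le; revert H2; unfold Rabs; destruct Rcase_abs; nra.
Qed.

(** The difference of the solutions is the potential of the difference of the sources. Inserting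
    [g1 (V2 + Z1)] splits the latter into a [g1] increment, treated by [one_sided_shift], and a
    defect evaluated along [V2] alone. No structure is asked of [g2], so [g2 = 0], [V2 = 0] is
    admissible and yields a priori bounds. *)
Lemma stability d T (g1 g2 : R -> R) Lam kappa eps (V1 V2 Z1 Z2 : R * Rn d -> R) :
  0 <= T -> 0 < Lam -> 0 <= kappa -> 0 <= eps ->
  BC g1 -> BC g2 -> BC V1 -> BC V2 -> BC Z1 -> BC Z2 ->
  (forall u v, Rabs (g1 u - g1 v) <= Lam * Rabs (u - v)) -> one_sided kappa g1 ->
  (forall p, V1 p = potc d T (fun p => g1 (V1 p + Z1 p)) p) ->
  (forall p, V2 p = potc d T (fun p => g2 (V2 p + Z2 p)) p) ->
  (forall p, Rabs (g1 (V2 p + Z1 p) - g2 (V2 p + Z2 p)) <= eps) ->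
  forall p, Rabs (V1 p - V2 p) <= eps * exp ((kappa + 1) * T).
Proof.
  intros HT HL Hk He Hg1 Hg2 HV1 HV2 HZ1 HZ2 Lg Og E1 E2 Hd.
  assert (H : forall t x, 0 <= t <= T -> Rabs (V1 (t, x) - V2 (t, x)) <= eps * exp ((kappa + 1) * t)).
  { apply (comparison d (fun p => g1 (V1 p + Z1 p) - g2 (V2 p + Z2 p)) (fun p => V1 p - V2 p) T Lam kappa eps);
      auto using BC_nonlin, BC_minus; try lra.
    - intros t x Ht; rewrite pot_minus, E1, E2 by (apply BC_nonlin; assumption).
      unfold potc; simpl; rewrite clamp_id by assumption; reflexivity.
    - intros t x Ht; set (p := (t, x)).
      replace (g1 (V1 p + Z1 p) - g2 (V2 p + Z2 p) + Lam * (V1 p - V2 p))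
        with ((g1 (V1 p + Z1 p) - g1 (V2 p + Z1 p) + Lam * (V1 p + Z1 p - (V2 p + Z1 p)))
              + (g1 (V2 p + Z1 p) - g2 (V2 p + Z2 p))) by ring.
      eapply Rle_trans; [apply Rabs_triang |]; apply Rplus_le_compat; [| apply Hd].
      replace (V1 p - V2 p) with (V1 p + Z1 p - (V2 p + Z1 p)) by ring.
      apply one_sided_shift; auto; lra. }
  intros [t x].
  assert (Ht := clamp_in 0 T t HT).
  replace (V1 (t, x) - V2 (t, x)) with (V1 (clamp 0 T t, x) - V2 (clamp 0 T t, x)).
  - eapply Rle_trans; [apply H, Ht |]; apply Rmult_le_compat_l; [assumption |].
    apply exp_mono; nra.
  - rewrite (E1 (t, x)), (E2 (t, x)), (E1 (clamp 0 T t, x)), (E2 (clamp 0 T t, x)).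
    unfold potc; simpl; rewrite clamp_id by assumption; reflexivity.
Qed.

Definition unif_cts (f : R -> R) : Prop := forall eps, 0 < eps ->
  exists delta, 0 < delta /\ forall u v, Rabs (u - v) <= delta -> Rabs (f u - f v) <= eps.

(* Steklov averages [1/h * int_u^(u+h) f]. *)
Lemma steklov_approx (f : R -> R) kappa eps :
  BC f -> unif_cts f -> one_sided kappa f -> 0 < eps ->
  exists g Lam, 0 < Lam /\ bnd g /\ (forall u v, Rabs (g u - g v) <= Lam * Rabs (u - v)) /\
    one_sided kappa g /\ forall u, Rabs (g u - f u) <= eps.
Proof.
  intros [Hf [B HB]] Hu Ho He.
  destruct (Hu eps He) as [h [Hh Hfh]].
  assert (Hs : forall u, cts (fun r => f (u + r))).
  { intros u; apply (cts_comp f (fun r : R => u + r) Hf); ctac. }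
  assert (HB0 : 0 <= B) by (generalize (HB 0) (Rabs_pos (f 0)); lra).
  assert (Hi : 0 < / h) by (apply Rinv_0_lt_compat, Hh).
  set (g := fun u => / h * RInt (fun r => f (u + r)) 0 h).
  assert (Hgb : forall (k : R -> R) M, cts k -> (forall r, 0 <= r <= h -> Rabs (k r) <= M) ->
     Rabs (/ h * RInt k 0 h) <= M).
  { intros k M Hk HM; rewrite Rabs_mult, (Rabs_pos_eq (/ h)) by lra.
    apply Rle_trans with (/ h * ((h - 0) * M)); [| right; field; lra].
    apply Rmult_le_compat_l; [lra |].
    apply abs_RInt_le_const; auto using ex_RInt_cts; lra. }
  (* After cancellation of the overlap of two windows, two end pieces of length at most
     [Rabs (u - v)] remain, whence [2 * B / h]; the added 1 ensures positivity when [B = 0]. *)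
  exists g, (2 * B / h + 1); repeat split.
  - assert (0 <= 2 * B / h) by (apply Rdiv_le_0_compat; lra); lra.
  - exists B; intros u; apply (Hgb (fun r => f (u + r))); auto.
  - intros u v.
    assert (Hsh : forall u, RInt (fun r => f (u + r)) 0 h = RInt f u (u + h)).
    { intros w; assert (H := RInt_comp_lin f 1 w 0 h).
      replace (1 * 0 + w) with w in H by ring; replace (1 * h + w) with (w + h) in H by ring.
      rewrite <- H by apply ex_RInt_cts, Hf.
      apply RInt_ext; intros r _; unfold scal; simpl; unfold mult; simpl.
      rewrite !Rmult_1_l; f_equal; ring. }
    assert (Hch : forall a b c, RInt f a b + RInt f b c = RInt f a c).
    { intros a b c; apply (RInt_Chasles f); apply ex_RInt_cts, Hf. }
    assert (E : g u - g v = / h * (RInt f (v + h) (u + h) - RInt f v u)).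
    { unfold g; rewrite !Hsh, <- (Hch u v (u + h)), <- (Hch v (v + h) (u + h)).
      assert (H := Hch v u v); rewrite RInt_point in H; unfold zero in H; simpl in H.
      replace (RInt f u v) with (- RInt f v u) by lra; ring. }
    assert (Hb : forall a b, Rabs (RInt f a b) <= Rabs (b - a) * B).
    { intros a b; apply Rabs_RInt_le; auto. }
    rewrite E, Rabs_mult, (Rabs_pos_eq (/ h)) by lra.
    generalize (Hb (v + h) (u + h)) (Hb v u).
    replace (u + h - (v + h)) with (u - v) by ring; intros H1 H2.
    assert (H3 : Rabs (RInt f (v + h) (u + h) - RInt f v u) <= 2 * B * Rabs (u - v)).
    { revert H1 H2; generalize (Rabs (u - v)); intros; revert H1 H2.
      unfold Rabs; repeat destruct Rcase_abs; lra. }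
    apply Rle_trans with (/ h * (2 * B * Rabs (u - v))); [apply Rmult_le_compat_l; lra |].
    generalize (Rabs_pos (u - v)); unfold Rdiv; nra.
  - intros u1 u2 Hu12; unfold g.
    rewrite <- Rmult_minus_distr_l, <- RInt_minus_cts by apply Hs.
    apply Rmult_le_reg_l with h; [assumption |].
    rewrite <- Rmult_assoc, Rinv_r, Rmult_1_l by lra.
    apply Rle_trans with (RInt (fun _ => kappa * (u2 - u1)) 0 h).
    + apply RInt_le_cts; [lra | apply cts_minus; apply Hs | apply cts_const |].
      intros r _; replace (u2 - u1) with (u2 + r - (u1 + r)) by ring; apply Ho; lra.
    + rewrite RInt_const; unfold scal; simpl; unfold mult; simpl; right; ring.
  - intros u; unfold g.
    replace (f u) with (/ h * RInt (fun _ => f u) 0 h).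
    + rewrite <- Rmult_minus_distr_l, <- RInt_minus_cts by (apply Hs || apply cts_const).
      apply Hgb; [apply cts_minus; [apply Hs | apply cts_const] |].
      intros r Hr; apply Hfh; replace (u + r - u) with r by ring; rewrite Rabs_pos_eq; lra.
    + rewrite RInt_const; unfold scal; simpl; unfold mult; simpl; field; lra.
Qed.

(** The bound on [V] sees [f] only along [Z]. This is what allows a truncation level to be fixed in
    terms of the untruncated [f] without circularity. *)
Lemma dissipative_solution d T (f : R -> R) kappa (Z : R * Rn d -> R) :
  0 <= T -> 0 <= kappa -> BC f -> unif_cts f -> one_sided kappa f -> BC Z ->
  exists V, BC V /\ (forall p, V p = potc d T (fun p => f (V p + Z p)) p) /\
    forall C, (forall p, Rabs (f (Z p)) <= C) -> forall p, Rabs (V p) <= C * exp ((kappa + 1) * T).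
Proof.
  intros HT Hk Hf Hu Ho HZ.
  set (e := fun n : nat => / (INR n + 1)).
  assert (He : forall n, 0 < e n).
  { intros n; apply Rinv_0_lt_compat; generalize (pos_INR n); lra. }
  assert (Hes : forall x, 0 < x -> exists N, forall n, (N <= n)%nat -> e n <= x).
  { intros x Hx; destruct (small_tail 1 x Hx) as [M [HM HMx]].
    destruct (nfloor_ex M ltac:(lra)) as [N HN]; exists N; intros n Hn.
    apply le_INR in Hn; left; eapply Rle_lt_trans; [| exact HMx].
    unfold e, Rdiv; rewrite Rmult_1_l; apply Rinv_le_contravar; lra. }
  assert (Hex : forall n, exists gV : (R -> R) * (R * Rn d -> R) * R,
    let g := fst (fst gV) in let V := snd (fst gV) in let Lam := snd gV in
    0 < Lam /\ BC g /\ (forall u v, Rabs (g u - g v) <= Lam * Rabs (u - v)) /\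
    one_sided kappa g /\ (forall u, Rabs (g u - f u) <= e n) /\
    BC V /\ forall p, V p = potc d T (fun p => g (V p + Z p)) p).
  { intros n; destruct (steklov_approx f kappa (e n) Hf Hu Ho (He n)) as [g [Lam [H1 [H2 [H3 [H4 H5]]]]]].
    destruct (lipschitz_solution d T g Lam Z HT H1 H2 H3 HZ) as [V [HV EV]].
    exists (g, V, Lam); simpl; split; [assumption |].
    split; [split; [apply (cts_lip g Lam); assumption | assumption] |]; auto 10. }
  (* Choice is used to extract the sequence of approximations together with their solutions. *)
  set (gV := fun n => proj1_sig (constructive_indefinite_description _ (Hex n))).
  set (g := fun n => fst (fst (gV n))); set (V := fun n => snd (fst (gV n))).
  assert (HgV : forall n, exists Lam, 0 < Lam /\ BC (g n) /\
    (forall u v, Rabs (g n u - g n v) <= Lam * Rabs (u - v)) /\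
    one_sided kappa (g n) /\ (forall u, Rabs (g n u - f u) <= e n) /\
    BC (V n) /\ forall p, V n p = potc d T (fun p => g n (V n p + Z p)) p).
  { intros n; exists (snd (gV n)); unfold g, V, gV.
    destruct constructive_indefinite_description as [w Hw]; exact Hw. }
  set (K := exp ((kappa + 1) * T)).
  assert (HK : 0 < K) by apply exp_pos.
  destruct (BC_complete V) as [W [HW HVW]].
  { intros n; destruct (HgV n) as [Lam H]; apply H. }
  { intros eps Heps; assert (Hx : 0 < eps / (2 * K)) by (apply Rdiv_lt_0_compat; lra).
    destruct (Hes _ Hx) as [N HN]; exists N; intros n m p Hn Hm.
    destruct (HgV n) as [Lam [H1 [H2 [H3 [H4 [H5 [H6 H7]]]]]]].
    destruct (HgV m) as [Lam' [H1' [H2' [H3' [H4' [H5' [H6' H7']]]]]]].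
    apply Rle_trans with ((e n + e m) * K).
    - apply (stability d T (g n) (g m) Lam kappa (e n + e m) (V n) (V m) Z Z); auto.
      + generalize (He n) (He m); lra.
      + intros q; generalize (H5 (V m q + Z q)) (H5' (V m q + Z q)).
        unfold Rabs; repeat destruct Rcase_abs; lra.
    - replace eps with ((eps / (2 * K) + eps / (2 * K)) * K) by (field; lra).
      apply Rmult_le_compat_r; [lra |]; generalize (HN n Hn) (HN m Hm); lra. }
  exists W; split; [exact HW |]; split.
  - intros p; apply eq_of_small; intros eps Heps.
    assert (Hx : 0 < eps / (1 + 2 * T)) by (apply Rdiv_lt_0_compat; lra).
    set (x := eps / (1 + 2 * T)) in *.
    destruct (Hu x Hx) as [de [Hde Hfde]].
    destruct (HVW _ Hx) as [N1 HN1]; destruct (HVW _ Hde) as [N2 HN2]; destruct (Hes _ Hx) as [N3 HN3].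
    set (n := (N1 + N2 + N3)%nat).
    destruct (HgV n) as [Lam [H1 [H2 [H3 [H4 [H5 [H6 H7]]]]]]].
    assert (A1 := HN1 n p ltac:(unfold n; lia)).
    (* One [x] comes from replacing [g n] by [f], the other from replacing [V n] by [W] through the
       modulus of continuity. *)
    assert (A2 : Rabs (V n p - potc d T (fun p => f (W p + Z p)) p) <= T * (2 * x)).
    { rewrite H7; apply (potc_diff d T (fun p => g n (V n p + Z p)) (fun p => f (W p + Z p)));
        auto using BC_nonlin.
      intros q.
      assert (B1 := H5 (V n q + Z q)).
      assert (B2 : Rabs (f (V n q + Z q) - f (W q + Z q)) <= x).
      { apply Hfde; replace (V n q + Z q - (W q + Z q)) with (V n q - W q) by ring.
        apply HN2; unfold n; lia. }
      assert (B3 := HN3 n ltac:(unfold n; lia)).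
      revert B1 B2; unfold Rabs; repeat destruct Rcase_abs; lra. }
    replace eps with (x + T * (2 * x)) by (unfold x; field; lra).
    revert A1 A2; unfold Rabs; repeat destruct Rcase_abs; lra.
  - intros C HC p; apply le_epsilon; intros eps Heps; fold K.
    assert (Hx : 0 < eps / (1 + K)) by (apply Rdiv_lt_0_compat; lra).
    set (x := eps / (1 + K)) in *.
    destruct (HVW _ Hx) as [N1 HN1]; destruct (Hes _ Hx) as [N3 HN3].
    set (n := (N1 + N3)%nat).
    destruct (HgV n) as [Lam [H1 [H2 [H3 [H4 [H5 [H6 H7]]]]]]].
    assert (A1 := HN1 n p ltac:(unfold n; lia)).
    assert (HC0 : 0 <= C) by (generalize (HC p) (Rabs_pos (f (Z p))); lra).
    assert (A2 : Rabs (V n p - 0) <= (C + x) * K).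
    { apply (stability d T (g n) (fun _ => 0) Lam kappa (C + x) (V n) (fun _ => 0) Z Z);
        auto using BC_const; try lra.
      - intros q; symmetry; apply potc_0.
      - intros q; rewrite Rplus_0_l, Rminus_0_r.
        generalize (H5 (Z q)) (HC q) (HN3 n ltac:(unfold n; lia)).
        unfold Rabs; repeat destruct Rcase_abs; lra. }
    replace (C * K + eps) with ((C + x) * K + x) by (unfold x; field; lra).
    revert A1 A2; unfold Rabs; repeat destruct Rcase_abs; lra.
Qed.

(** * Truncation and its removal *)

Lemma cts_bnd_interval (f : R -> R) a b : cts f -> exists B, forall x, a <= x <= b -> Rabs (f x) <= B.
Proof.
  intros Hf; destruct (Rle_dec a b) as [Hab |]; [| exists 0; intros; lra].
  destruct (continuity_ab_maj (fun x => Rabs (f x)) a b Hab) as [m [Hm _]].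
  - intros c _; apply continuity_pt_filterlim.
    apply (cts_comp Rabs f); [intros x; apply continuous_Rabs | exact Hf].
  - exists (Rabs (f m)); auto.
Qed.

Lemma mild_solution d T (f : R -> R) kappa (Z : R * Rn d -> R) :
  0 <= T -> 0 <= kappa -> cts f -> one_sided kappa f -> BC Z ->
  exists V, BC V /\ BC (fun p => f (V p + Z p)) /\
    forall t x, 0 <= t <= T -> V (t, x) = pot d (fun p => f (V p + Z p)) t x.
Proof.
  intros HT Hk Hf Ho HZ.
  destruct (proj2 HZ) as [z0 Hz0].
  assert (Hz : 0 <= z0) by (generalize (Hz0 (0, UniformSpace.point_of _ (Rn_mixin d)))
    (Rabs_pos (Z (0, UniformSpace.point_of _ (Rn_mixin d)))); lra).
  destruct (cts_bnd_interval f (- z0) z0 Hf) as [C HC].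
  assert (HC0 : 0 <= C) by (generalize (HC 0 ltac:(lra)) (Rabs_pos (f 0)); lra).
  (* [C] bounds [f] on [[- z0, z0]], where the truncated function agrees with [f] because [z0 <= M].
     The a priori bound then keeps [V + Z] within [[- M, M]]. *)
  set (M := z0 + C * exp ((kappa + 1) * T)).
  assert (HM : z0 <= M) by (unfold M; generalize (exp_pos ((kappa + 1) * T)); nra).
  set (fM := fun u => f (clamp (- M) M u)).
  assert (HcM : cts (clamp (- M) M)) by (apply cts_clamp; lra).
  assert (HfM : BC fM).
  { split; [apply (cts_comp f (clamp (- M) M)); assumption |].
    destruct (cts_bnd_interval f (- M) M Hf) as [B HB].
    exists B; intros u; apply HB, clamp_in; lra. }
  assert (HuM : unif_cts fM).
  { intros eps He.
    (* Heine-Cantor from the tube lemma: the increment is the parameter, taken near 0, and the base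
       point runs over [[- M, M]]. *)
    assert (HF : cts (fun p : R * R => f (snd p + fst p))).
    { apply (cts_comp f (fun p : R * R => snd p + fst p) Hf); ctac. }
    destruct (cts_tube (X := R_UniformSpace) (fun p => f (snd p + fst p)) 0 (- M) M eps HF He) as [de Hde].
    exists (de / 2); split; [destruct de; simpl; lra |]; intros u v Huv.
    assert (Hl := clamp_lip (- M) M u v ltac:(lra)).
    assert (H := Hde (clamp (- M) M u - clamp (- M) M v) (clamp (- M) M v)); simpl in H.
    replace (clamp (- M) M v + (clamp (- M) M u - clamp (- M) M v)) with (clamp (- M) M u) in H by ring.
    rewrite Rplus_0_r in H; left; apply H; [| apply clamp_in; lra].
    unfold ball; simpl; unfold AbsRing_ball, abs, minus, plus, opp; simpl.
    rewrite Ropp_0, Rplus_0_r; destruct de; simpl in *; lra. }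
  assert (HoM : one_sided kappa fM).
  { intros u v Huv; unfold fM.
    (* Clamping can only shorten the increment, so the one-sided bound survives because [kappa] is
       nonnegative. *)
    destruct (clamp_incr (- M) M u v ltac:(lra) ltac:(lra)) as [[H1 | H1] H2].
    - eapply Rle_trans; [apply Ho, H1 | apply Rmult_le_compat_l; lra].
    - rewrite H1, Rminus_diag; nra. }
  destruct (dissipative_solution d T fM kappa Z HT Hk HfM HuM HoM HZ) as [V [HV [EV BV]]].
  assert (Hlow : forall p, Rabs (V p) <= C * exp ((kappa + 1) * T)).
  { apply BV; intros p; unfold fM; generalize (Hz0 p); intros Hp.
    apply Rabs_le_between in Hp.
    rewrite clamp_id by lra; apply HC; lra. }
  assert (Hin : (fun p : R * Rn d => fM (V p + Z p)) = (fun p : R * Rn d => f (V p + Z p))).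
  { apply functional_extensionality; intros p; unfold fM; rewrite clamp_id; [reflexivity |].
    generalize (Hlow p) (Hz0 p); intros A1 A2.
    apply Rabs_le_between in A1; apply Rabs_le_between in A2; unfold M; lra. }
  assert (HfV := BC_nonlin fM V Z HfM HV HZ).
  rewrite Hin in EV.
  exists V; split; [exact HV |]; split.
  - split; [apply (cts_comp f (fun p => V p + Z p) Hf), cts_plus; [apply HV | apply HZ] |].
    destruct (proj2 HfV) as [B HB]; exists B; intros p; rewrite <- (f_equal (fun h => h p) Hin); apply HB.
  - intros t x Ht; rewrite EV; unfold potc; simpl; rewrite clamp_id by assumption; reflexivity.
Qed.

(** * Passage to iterated improper integrals against [G] *)

(** Balls of the product structure are coordinatewise, while [Cb] uses the Euclidean distance.
    Together with [dist_ball], this shows that both give the same notion of continuity. *)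
Lemma ball_sqnorm d eps : 0 < eps -> exists delta : posreal, forall x y : Rn d,
  ball x delta y -> Rn_sqnorm d (Rn_sub d y x) < eps.
Proof.
  revert eps; induction d as [| d IH]; intros eps He.
  - exists (mkposreal 1 Rlt_0_1); intros; simpl; assumption.
  - destruct (IH (eps / 2) ltac:(lra)) as [d1 Hd1].
    (* A radius at most 1 makes the square of a coordinate no larger than its absolute value, hence
       below [eps / 2]. *)
    assert (Hd2 : 0 < Rmin d1 (Rmin 1 (eps / 2))).
    { apply Rmin_glb_lt; [apply cond_pos | apply Rmin_glb_lt; lra]. }
    exists (mkposreal _ Hd2); intros [x1 x] [y1 y] [H1 H2]; simpl in H1, H2 |- *.
    assert (H3 : Rn_sqnorm d (Rn_sub d y x) < eps / 2).
    { apply Hd1; apply (ball_le x) with (2 := H2); apply Rmin_l. }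
    change (Rabs (y1 - x1) < Rmin d1 (Rmin 1 (eps / 2))) in H1.
    assert (H4 := Rle_trans _ _ _ (Rmin_r d1 (Rmin 1 (eps / 2))) (Rmin_l _ _)).
    assert (H5 := Rle_trans _ _ _ (Rmin_r d1 (Rmin 1 (eps / 2))) (Rmin_r _ _)).
    assert (H6 : (y1 - x1) * (y1 - x1) = Rabs (y1 - x1) * Rabs (y1 - x1)).
    { unfold Rabs; destruct Rcase_abs; ring. }
    generalize (Rabs_pos (y1 - x1)); nra.
Qed.

Lemma sqnorm_pos d (x : Rn d) : 0 <= Rn_sqnorm d x.
Proof. induction d as [| d IH]; simpl; [lra | generalize (IH (snd x)); nra]. Qed.

Lemma dist_ball d (x y : Rn d) e : Rn_dist d y x < e -> ball x e y.
Proof.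
  unfold Rn_dist; induction d as [| d IH]; intros H; [exact I |].
  destruct x as [x1 x], y as [y1 y]; simpl in H.
  assert (H0 := sqnorm_pos d (Rn_sub d y x)).
  split; simpl.
  - change (Rabs (y1 - x1) < e); eapply Rle_lt_trans; [| exact H].
    rewrite <- sqrt_Rsqr_abs; apply sqrt_le_1_alt; unfold Rsqr; lra.
  - apply (IH x y); eapply Rle_lt_trans; [| exact H].
    apply sqrt_le_1_alt; generalize (Rle_0_sqr (y1 - x1)); unfold Rsqr; lra.
Qed.

Lemma BC_of_Cb d T (z : R -> Rn d -> R) : 0 <= T -> Cb d T z ->
  BC (fun p : R * Rn d => z (clamp 0 T (fst p)) (snd p)).
Proof.
  intros HT [[C HC] Hc]; split.
  - apply cts_eps; intros [t x] eps He.
    destruct (Hc (clamp 0 T t) x (clamp_in 0 T t HT) eps He) as [de [Hde H]].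
    destruct (ball_sqnorm d (de * de) ltac:(nra)) as [d1 Hd1].
    assert (Hd2 : 0 < Rmin de d1) by (apply Rmin_glb_lt; [assumption | apply cond_pos]).
    exists (mkposreal _ Hd2); intros [s y] [H1 H2]; simpl in H1, H2 |- *.
    apply H; [apply clamp_in, HT | |].
    + eapply Rle_lt_trans; [apply clamp_lip, HT |].
      apply Rlt_le_trans with (Rmin de d1); [exact H1 | apply Rmin_l].
    + unfold Rn_dist; rewrite <- (sqrt_square de) by lra.
      apply sqrt_lt_1_alt; split; [apply sqnorm_pos |].
      apply Hd1; apply (ball_le x) with (2 := H2); apply Rmin_r.
  - exists C; intros p; apply HC, clamp_in, HT.
Qed.

Lemma Cb_of_BC d T (F : R * Rn d -> R) : BC F -> Cb d T (fun t x => F (t, x)).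
Proof.
  intros [Hc [B HB]]; split; [exists B; auto |].
  intros t x _ eps He; destruct (proj1 (cts_eps F) Hc (t, x) eps He) as [de Hde].
  exists de; split; [apply cond_pos |]; intros s y _ H1 H2.
  apply Hde; split; [exact H1 | apply dist_ball, H2].
Qed.

Lemma is_RInt_Defs (f : R -> R) a b : ex_RInt f a b -> Defs.is_RInt f a b (RInt f a b).
Proof. intros H; exists (ex_RInt_Reals_0 f a b H); symmetry; apply RInt_Reals. Qed.

Lemma is_RInt_Defs_unique (f : R -> R) a b w : Defs.is_RInt f a b w -> w = RInt f a b.
Proof. intros [pr <-]; symmetry; apply RInt_Reals. Qed.

(** The substitution [y = x + sqrt tau * r] turns the kernel into [gphi]; [gint_tail] then gives
    convergence for arbitrary, not only symmetric, endpoints. *)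
Lemma is_RInt_R_gauss (k : R -> R) x tau C : BC k -> 0 < tau ->
  is_RInt_R (fun y => C * exp (- ((x - y) * (x - y)) / (2 * tau)) * k y)
    (C * (sqrt tau * gint (fun _ => 1)) * gauss (fun r => k (x + sqrt tau * r))).
Proof.
  intros [Hk [B HB]] Ht.
  assert (Hs : 0 < sqrt tau) by (apply sqrt_lt_R0, Ht).
  assert (Hss : sqrt tau * sqrt tau = tau) by (apply sqrt_sqrt; lra).
  set (s := sqrt tau) in *.
  assert (HG : (fun y => C * exp (- ((x - y) * (x - y)) / (2 * tau)) * k y) =
               (fun y => C * (gphi ((y - x) / s) * k y))).
  { apply functional_extensionality; intros y; unfold gphi.
    replace (- ((y - x) / s * ((y - x) / s)) / 2) with (- ((x - y) * (x - y)) / (2 * tau))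
      by (rewrite <- Hss; field; lra).
    ring. }
  assert (Hc : cts (fun y => gphi ((y - x) / s) * k y)).
  { apply cts_mult; [| assumption]; unfold Rdiv.
    apply (cts_comp gphi (fun y : R => (y - x) * / s) cts_gphi); ctac. }
  assert (Hc' : cts (fun y => C * (gphi ((y - x) / s) * k y))) by (apply cts_mult; [apply cts_const | exact Hc]).
  assert (Hka : cts (fun r => k (x + s * r))) by (apply (cts_comp k _ Hk), cts_affine).
  rewrite HG; split.
  - intros a b _; eexists; apply is_RInt_Defs, ex_RInt_cts, Hc'.
  - intros eps He.
    destruct (small_tail (Rabs C * s * (4 * B)) eps He) as [N [HN HN']].
    exists (s * N + Rabs x); intros a b w Ha Hb Hw.
    apply is_RInt_Defs_unique in Hw; subst w.
    rewrite RInt_scal_cts, (RInt_gphi_affine k) by assumption.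
    set (I := RInt _ _ _).
    assert (HI : Rabs (I - gint (fun r => k (x + s * r))) <= 4 * B / N).
    { apply (gint_tail (fun r => k (x + s * r))); auto.
      - apply Rmult_le_reg_r with s; [assumption |].
        unfold Rdiv; rewrite Rmult_assoc, Rinv_l by lra.
        revert Ha; unfold Rabs; destruct Rcase_abs; lra.
      - apply Rmult_le_reg_r with s; [assumption |].
        unfold Rdiv; rewrite Rmult_assoc, Rinv_l by lra.
        revert Hb; unfold Rabs; destruct Rcase_abs; lra. }
    unfold gauss.
    replace (C * (s * I) - C * (s * gint (fun _ => 1)) * (gint (fun r => k (x + s * r)) / gint (fun _ => 1)))
      with (C * s * (I - gint (fun r => k (x + s * r)))) by (field; apply Rgt_not_eq, gint_1_pos).
    rewrite !Rabs_mult, (Rabs_pos_eq s) by lra.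
    eapply Rle_lt_trans; [| exact HN'].
    replace (Rabs C * s * (4 * B) / N) with (Rabs C * s * (4 * B / N)) by (field; lra).
    apply Rmult_le_compat_l; [generalize (Rabs_pos C); nra | exact HI].
Qed.

(** The prefactor [C] is general so that, for a fixed first coordinate, the corresponding
    exponential can be absorbed into it before the induction hypothesis is used. *)
Lemma is_int_Rn_gaussn d (x : Rn d) tau C (g : Rn d -> R) : BC g -> 0 < tau ->
  is_int_Rn d (fun y => C * exp (- Rn_sqnorm d (Rn_sub d x y) / (2 * tau)) * g y)
    (C * (sqrt tau * gint (fun _ => 1)) ^ d * gaussn d (fun y => g (axpy d x (sqrt tau) y))).
Proof.
  intros Hg Ht; revert x C g Hg; induction d as [| d IH]; intros x C g Hg.
  - simpl; replace (- 0 / (2 * tau)) with 0 by (field; lra); rewrite exp_0.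
    destruct x; ring.
  - destruct x as [x1 x]; simpl.
    exists (fun y1 => C * exp (- ((x1 - y1) * (x1 - y1)) / (2 * tau)) * (sqrt tau * gint (fun _ => 1)) ^ d
              * gaussn d (fun y => g (y1, axpy d x (sqrt tau) y))); split.
    + intros y1.
      replace (fun y : Rn d => C * exp (- ((x1 - y1) * (x1 - y1) + Rn_sqnorm d (Rn_sub d x y)) / (2 * tau)) * g (y1, y))
        with (fun y : Rn d => C * exp (- ((x1 - y1) * (x1 - y1)) / (2 * tau)) * exp (- Rn_sqnorm d (Rn_sub d x y) / (2 * tau)) * g (y1, y)).
      * apply (IH x _ (fun y => g (y1, y))), BC_slice_Rn, Hg.
      * apply functional_extensionality; intros y.
        rewrite (Rmult_assoc C), <- exp_plus; do 3 f_equal; field; lra.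
    + replace (fun y1 => C * exp (- ((x1 - y1) * (x1 - y1)) / (2 * tau)) * (sqrt tau * gint (fun _ => 1)) ^ d
              * gaussn d (fun y => g (y1, axpy d x (sqrt tau) y)))
        with (fun y1 => (C * (sqrt tau * gint (fun _ => 1)) ^ d) * exp (- ((x1 - y1) * (x1 - y1)) / (2 * tau))
              * gaussn d (fun y => g (y1, axpy d x (sqrt tau) y)))
        by (apply functional_extensionality; intros; ring).
      replace (C * (sqrt tau * gint (fun _ => 1) * (sqrt tau * gint (fun _ => 1)) ^ d))
        with (C * (sqrt tau * gint (fun _ => 1)) ^ d * (sqrt tau * gint (fun _ => 1))) by ring.
      apply (is_RInt_R_gauss (fun y1 => gaussn d (fun y => g (y1, axpy d x (sqrt tau) y)))); [| assumption].
      apply (BC_gaussn (X := R_UniformSpace) d (fun z => g (fst z, axpy d x (sqrt tau) (snd z)))).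
      apply (BC_comp (Y := prod_UniformSpace R_UniformSpace (Rn_UniformSpace d)) g
         (fun z : R * Rn d => (fst z, axpy d x (sqrt tau) (snd z))) Hg); ctac.
Qed.

(* The mass of [G d t]; its value, which is 1, plays no role. *)
Definition kernel_mass (d : nat) : R := (gint (fun _ => 1) / sqrt (2 * PI)) ^ d.

Lemma kernel_mass_pos d : 0 < kernel_mass d.
Proof.
  apply pow_lt, Rdiv_lt_0_compat; [apply gint_1_pos |].
  apply sqrt_lt_R0; generalize PI_RGT_0; lra.
Qed.

(** The powers of [tau] cancel, so the mass is the same at all times and can be moved into the
    nonlinearity as a constant. *)
Lemma kernel_normalization d tau : 0 < tau ->
  Rpower (2 * PI * tau) (- INR d / 2) * (sqrt tau * gint (fun _ => 1)) ^ d = kernel_mass d.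
Proof.
  intros Ht.
  assert (HP : 0 < 2 * PI) by (generalize PI_RGT_0; lra).
  assert (H : 0 < 2 * PI * tau) by (apply Rmult_lt_0_compat; assumption).
  assert (H1 : 0 < sqrt (2 * PI)) by (apply sqrt_lt_R0, HP).
  assert (H2 : 0 < sqrt tau) by (apply sqrt_lt_R0, Ht).
  replace (- INR d / 2) with (/ 2 * - INR d) by field.
  rewrite <- Rpower_mult, Rpower_sqrt, Rpower_Ropp, Rpower_pow by (try apply sqrt_lt_R0; assumption).
  rewrite sqrt_mult by lra; unfold kernel_mass, Rdiv.
  rewrite !Rpow_mult_distr, pow_inv; field; split; apply pow_nonzero; lra.
Qed.

Lemma is_int_Rn_heat d (F : R * Rn d -> R) t s x : BC F -> s < t ->
  is_int_Rn d (fun y => G d (t - s) (Rn_sub d x y) * F (s, y)) (kernel_mass d * heat d F t s x).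
Proof.
  intros HF Hst; unfold G, heat.
  rewrite <- (kernel_normalization d (t - s)) by lra.
  apply (is_int_Rn_gaussn d x (t - s) _ (fun y => F (s, y))); [| lra].
  apply (BC_slice (X := R_UniformSpace) (Y := Rn_UniformSpace d) F s HF).
Qed.

Theorem mainTheorem9 :
  forall (d : nat) (f : R -> R) (kappa : R),
    continuity f ->
    (forall u1 u2, u1 < u2 -> f u2 - f u1 <= kappa * (u2 - u1)) ->
    forall (T : R), 0 < T ->
    forall (z : R -> Rn d -> R), Cb d T z ->
    exists u : R -> Rn d -> R,
      Cb d T u /\
      forall t x, 0 <= t <= T -> mild_eq d f u z t x.
Proof.
  intros d f kappa Hf Ho T HT z Hz.
  assert (Hm := kernel_mass_pos d); set (m := kernel_mass d) in *.
  set (Z := fun p : R * Rn d => z (clamp 0 T (fst p)) (snd p)).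
  assert (HZ : BC Z) by (apply BC_of_Cb; [lra | assumption]).
  apply cts_continuity in Hf.
  (* The kernel is [m] times the Gaussian average, so [m * f] is the effective nonlinearity.
     Replacing [kappa] by [Rmax kappa 0] weakens the hypothesis and supplies the sign that the
     comparison needs. *)
  destruct (mild_solution d T (fun u => m * f u) (m * Rmax kappa 0) Z) as [V [HV [HfV EV]]].
  - lra.
  - generalize (Rmax_r kappa 0); nra.
  - apply cts_mult; [apply cts_const | exact Hf].
  - intros u1 u2 H; generalize (Ho u1 u2 H) (Rmax_l kappa 0); intros H1 H2.
    rewrite <- Rmult_minus_distr_l, Rmult_assoc.
    apply Rmult_le_compat_l; [lra |].
    eapply Rle_trans; [exact H1 | apply Rmult_le_compat_r; lra].
  - exact HZ.
  - assert (HfV' : BC (fun p => f (V p + Z p))).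
    { replace (fun p => f (V p + Z p)) with (fun p => / m * (m * f (V p + Z p)))
        by (apply functional_extensionality; intros; field; lra).
      apply BC_mult; [apply BC_const | exact HfV]. }
    exists (fun t x => V (t, x) + Z (t, x)); split.
    + apply (Cb_of_BC d T (fun p => V p + Z p)), BC_plus; assumption.
    (* This integrand agrees with the kernel integral for [s < t] and extends it continuously to
       [s = t], where the kernel formula degenerates. *)
    + intros t x Ht; exists (fun s => heat d (fun p => m * f (V p + Z p)) t s x); split.
      * intros s Hs.
        replace (heat d (fun p => m * f (V p + Z p)) t s x)
          with (m * heat d (fun p => f (V p + Z p)) t s x).
        { apply (is_int_Rn_heat d (fun p => f (V p + Z p))); [exact HfV' | lra]. }
        symmetry; apply gaussn_scal.
        apply (BC_slice_heat d (fun p => f (V p + Z p))), HfV'.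
      * assert (E : V (t, x) + Z (t, x) - z t x = pot d (fun p => m * f (V p + Z p)) t x).
        { rewrite <- EV by assumption; unfold Z; simpl; rewrite clamp_id by assumption; ring. }
        refine (eq_ind_r (Defs.is_RInt _ 0 t) _ E); apply is_RInt_Defs, ex_RInt_cts, BC_heat_time, HfV.
Qed.
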